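(* Let $m\ge 1$, $1\le p<\infty$, let $X$ be any one of the four sets $\widetilde{S}^{m}$, $E^{m}$, $S_0^{m}$, $S^{m}$, and let $U\subset X$. Then $U$ is compact in $(X,d_p)$ if and only if $U$ is closed in $(X,d_p)$ and (i) $U$ is uniformly $p$-mean bounded; (ii) $U$ is $p$-mean equi-left-continuous; and (iii$'$) for every sequence $\{u_n: n=1,2,\ldots\}\subset U$ there exist $r>0$ and a subsequence $\{v_n\}$ of $\{u_n\}$ such that $\lim_{n\to\infty}|v_n|^r=0$, where $|\cdot|^r$ is the functional defined in the context (the $r$ is a superscript index, not a power).
   Context: $H$ is the Hausdorff metric on nonempty closed subsets of $\mathbb{R}^m$ (Euclidean distance): $H(A,B)=\max\{\sup_{a\in A}\inf_{b\in B}d(a,b),\ \sup_{b\in B}\inf_{a\in A}d(a,b)\}$. A fuzzy set on $\mathbb{R}^m$ is a function $u:\mathbb{R}^m\to[0,1]$; its cuts are $[u]_\alpha=\{x: u(x)\ge\alpha\}$ for $\alpha\in(0,1]$ and $[u]_0=\overline{\{x: u(x)>0\}}$. $F_B(\mathbb{R}^m)$ is the set of fuzzy sets $u$ on $\mathbb{R}^m$ that are normal ($u(x_0)=1$ for some $x_0$), upper semi-continuous, and have $[u]_0$ bounded. The metric is $d_p(u,v)=\left(\int_0^1 H([u]_\alpha,[v]_\alpha)^p\,d\alpha\right)^{1/p}$. Subsets of $F_B(\mathbb{R}^m)$: - $E^{m}$: those $u$ that are fuzzy convex, i.e. $u(\lambda x+(1-\lambda)y)\ge\min\{u(x),u(y)\}$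 for all $x,y\in\mathbb{R}^m$, $\lambda\in[0,1]$; - $S_0^{m}$: those $u$ with $u(\lambda y)\ge u(y)$ for all $y\in\mathbb{R}^m$, $\lambda\in[0,1]$; - $S^{m}$: those $u$ for which there is $x\in\mathbb{R}^m$ with $u(\lambda y+(1-\lambda)x)\ge u(y)$ for all $y\in\mathbb{R}^m$, $\lambda\in[0,1]$; - $\widetilde{S}^{m}$: those $u$ such that for every $\alpha\in(0,1]$ there is $x_\alpha\in[u]_\alpha$ such that for all $y\in[u]_\alpha$ the segment $\overline{x_\alpha y}$ is contained in $[u]_\alpha$. A set $U$ of such fuzzy sets is uniformly $p$-mean bounded if there is $M>0$ with $d_p(u,\widehat{0})\le M$ for all $u\in U$, where $\widehat 0$ is the characteristic function of $\{0\}$ ($0$ the origin). $U$ is $p$-mean equi-left-continuous if for every $\varepsilon>0$ there is $\delta>0$ such that for all $0\le h<\delta$ and all $u\in U$, $\left(\int_h^1 H([u]_\alpha,[u]_{\alpha-h})^p\,d\alpha\right)^{1/p}<\varepsilon$. For $r>0$ let $B_r=\{x\in\mathbb{R}^m:\|x\|\le r\}$, let $\widehat{B_r}$ be its characteristic function, and for $u\in F_B(\mathbb{R}^m)$ put $|u|^r:=\left(\int_0^1 H([u\vee\widehat{B_r}]_\alpha,[\widehat{B_r}]_\alpha)^p\,d\alpha\right)^{1/p}$, where $\vee$ is the pointwise maximum. *)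

(* Defs.v *)
From HB Require Import structures.
From mathcomp Require Import all_boot all_order all_algebra.
From mathcomp Require Import all_classical all_reals all_analysis.

Set Implicit Arguments.
Unset Strict Implicit.
Unset Printing Implicit Defensive.

Import Order.TTheory GRing.Theory Num.Theory.
Import numFieldNormedType.Exports.

Local Open Scope classical_set_scope.
Local Open Scope ring_scope.

Section Hausdorff.
Context {R : realType} {m : nat}.
Implicit Types (x y : 'rV[R]_m) (A B : set 'rV[R]_m).

(* The canonical norm on 'rV[R]_m is the sup norm, so the Euclidean norm has to
   be spelled out. Both induce the same topology: open, closure and nbhs are
   those of the library. *)
Definition enorm x : R := Num.sqrt (\sum_(i < m) (x ord0 i) ^+ 2).

Definition edistance x y : R := enorm (x - y).

(* Extended-real valued, so that suprema and infima never take junk values. *)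
Definition hausdorff_dist A B : \bar R :=
  Order.max
    (ereal_sup [set ereal_inf [set (edistance a b)%:E | b in B] | a in A])
    (ereal_sup [set ereal_inf [set (edistance a b)%:E | a in A] | b in B]).

End Hausdorff.

Section FuzzySets.
Context {R : realType} {m : nat}.
Implicit Types (u v : 'rV[R]_m -> R) (a : R).

Definition fuzzy_set u := forall x, 0 <= u x <= 1.

(* Only meaningful for a in [0, 1]. *)
Definition acut u a : set 'rV[R]_m :=
  if a == 0 then closure [set x | 0 < u x] else [set x | a <= u x].

Definition normal_fuzzy u := exists x, u x = 1.

Definition upper_semicontinuous u :=
  forall x a, u x < a -> \forall y \near x, u y < a.

Definition bounded_support u := exists M : R, forall x, acut u 0 x -> enorm x <= M.

Definition FB : set ('rV[R]_m -> R) :=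
  [set u | [/\ fuzzy_set u, normal_fuzzy u, upper_semicontinuous u &
               bounded_support u]].

End FuzzySets.
Arguments FB : clear implicits.

Section FuzzyClasses.
Variables (R : realType) (m : nat).

Definition fuzzy_E : set ('rV[R]_m -> R) :=
  [set u | FB R m u /\
    forall x y (l : R), 0 <= l <= 1 ->
      Num.min (u x) (u y) <= u (l *: x + (1 - l) *: y)].

Definition fuzzy_S0 : set ('rV[R]_m -> R) :=
  [set u | FB R m u /\
    forall y (l : R), 0 <= l <= 1 -> u y <= u (l *: y)].

Definition fuzzy_S : set ('rV[R]_m -> R) :=
  [set u | FB R m u /\
    exists x, forall y (l : R), 0 <= l <= 1 -> u y <= u (l *: y + (1 - l) *: x)].

Definition fuzzy_Stilde : set ('rV[R]_m -> R) :=
  [set u | FB R m u /\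
    forall a : R, 0 < a <= 1 ->
      exists2 xa, acut u a xa &
        forall y, acut u a y ->
          forall l : R, 0 <= l <= 1 -> acut u a (l *: y + (1 - l) *: xa)].

End FuzzyClasses.
Arguments fuzzy_E : clear implicits.
Arguments fuzzy_S0 : clear implicits.
Arguments fuzzy_S : clear implicits.
Arguments fuzzy_Stilde : clear implicits.

Section Metric.
Context {R : realType} {m : nat}.
Variable p : R.
Implicit Types (u v : 'rV[R]_m -> R) (U : set ('rV[R]_m -> R)).

Definition dp u v : \bar R :=
  ((\int[lebesgue_measure]_(a in `[0%R, 1%R])
      (hausdorff_dist (acut u a) (acut v a) `^ p)) `^ p^-1)%E.

Definition eball (r : R) : set 'rV[R]_m := [set x | enorm x <= r].

Definition zero_hat : 'rV[R]_m -> R := \1_[set 0].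

Definition ball_hat (r : R) : 'rV[R]_m -> R := \1_(eball r).

Definition p_mean_bounded U :=
  exists2 M : R, 0 < M & forall u, U u -> (dp u zero_hat <= M%:E)%E.

(* For h > 1 the domain of integration is empty; since d can be decreased
   freely, such h are harmless. *)
Definition p_mean_equi_left_continuous U :=
  forall e : R, 0 < e -> exists2 d : R, 0 < d &
    forall h : R, 0 <= h < d -> forall u, U u ->
      ((\int[lebesgue_measure]_(a in `[h, 1%R])
          (hausdorff_dist (acut u a) (acut u (a - h)%R) `^ p)) `^ p^-1 < e%:E)%E.

Definition excess (r : R) u : \bar R :=
  ((\int[lebesgue_measure]_(a in `[0%R, 1%R])
      (hausdorff_dist (acut (u \max ball_hat r) a) (acut (ball_hat r) a) `^ p))
   `^ p^-1)%E.

End Metric.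

(* The space (X, dp p), for X a set of functions. The parameter p only selects
   the topology. *)
Record dp_space (R : realType) (m : nat) (p : R) (X : set ('rV[R]_m -> R)) :=
  DpSpace { dp_val :> 'rV[R]_m -> R ; dp_valP : X dp_val }.

Section Topology.
Context {R : realType} {m : nat}.
Variables (p : R) (X : set ('rV[R]_m -> R)).
Local Notation T := (dp_space p X).

Definition dp_ball (u : T) (e : R) : set T := [set v : T | (dp p u v < e%:E)%E].

Definition dp_open : set_system T :=
  [set V | forall u, V u -> exists2 e : R, 0 < e & dp_ball u e `<=` V].

Lemma dp_openT : dp_open setT.
Proof. by move=> u _; exists 1. Qed.

Lemma dp_openI : setI_closed dp_open.
Proof.
move=> V W oV oW u [/oV[e e0 eV] /oW[f f0 fW]].
exists (Num.min e f); first by rewrite lt_min e0.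
move=> v uv; split.
  by apply/eV/(lt_le_trans uv); rewrite lee_fin ge_min lexx.
by apply/fW/(lt_le_trans uv); rewrite lee_fin ge_min lexx orbT.
Qed.

Lemma dp_open_bigU (I : Type) (f : I -> set T) :
  (forall i, dp_open (f i)) -> dp_open (\bigcup_i f i).
Proof.
move=> of_ u [i _ /of_[e e0 eV]]; exists e => // v /eV fv.
by exists i.
Qed.

HB.instance Definition _ := gen_eqMixin T.
HB.instance Definition _ := gen_choiceMixin T.
HB.instance Definition _ :=
  isOpenTopological.Build T dp_openT dp_openI dp_open_bigU.

End Topology.

(* Main.v *)
Require Import Defs.
From mathcomp Require Import all_boot all_order all_algebra.
From mathcomp Require Import all_classical all_reals all_analysis.
From mathcomp Require Import measurable_realfun ring lra.
Import Order.TTheory GRing.Theory Num.Theory.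
Import numFieldNormedType.Exports.
Local Open Scope classical_set_scope.
Local Open Scope ring_scope.

Set Implicit Arguments.
Unset Strict Implicit.
Unset Printing Implicit Defensive.

(* Each cut family [a |-> acut u a] is decreasing, consists of nonempty compact
   sets and is left continuous for the Hausdorff metric, so all distances are
   L^p norms of bounded left-continuous functions and Minkowski applies.

   Necessity. Along a cluster point [v] of a sequence [u_n] of U, translation
   invariance of the Lebesgue measure bounds the mean modulus of left continuity
   of [u_n] by that of [v] plus [2 d_p(u_n, v)], and [|u_n|^r <= d_p(u_n, v)] as
   soon as the ball [B_r] contains the support of [v].

   Sufficiency. Monotonicity of the cuts and (iii') confine [acut (v_n) a] to
   [B_(r+e)] for n large. Along an ultrafilter on nat every sequence of cuts
   then has a Hausdorff limit [L_a], and the limit fuzzy set [u] has the cuts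
   [\bigcap_(b < a) L_b]. For n such that the cuts of [v_n] at the finitely
   many levels [k h] are close to [L_(k h)], monotonicity gives, up to a small
   error, [H([v_n]_a, [u]_a) <= H([u]_a, [u]_(a-h)) + H([u]_(a+h), [u]_a)] when
   [h < a <= 1 - h], while [2 r] plus the excess of [v_n] bounds it on the two
   remaining intervals of length h. The L^p norms of these bounds tend to 0
   with h because [u] is left continuous in mean. *)

(** * The Euclidean norm and its equivalence with the sup norm *)

Section EuclideanNorm.
Context {R : realType} {m : nat}.
Implicit Types x y z : 'rV[R]_m.

Lemma enorm_ge0 x : 0 <= enorm x.
Proof. exact: sqrtr_ge0. Qed.

Lemma sqr_enorm x : enorm x ^+ 2 = \sum_(i < m) x ord0 i ^+ 2.
Proof. by rewrite sqr_sqrtr//; apply: sumr_ge0 => i _; exact: sqr_ge0. Qed.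

Lemma enorm_le x r : 0 <= r ->
  \sum_(i < m) x ord0 i ^+ 2 <= r ^+ 2 -> enorm x <= r.
Proof. by move=> r0 xr; rewrite -(ler_pXn2r (ltn0Sn 1)) ?nnegrE ?enorm_ge0// sqr_enorm. Qed.

Lemma enorm0 : enorm (0 : 'rV[R]_m) = 0.
Proof.
apply/eqP; rewrite -sqrf_eq0 sqr_enorm big1// => i _.
by rewrite mxE expr0n.
Qed.

Lemma enormN x : enorm (- x) = enorm x.
Proof. by rewrite /enorm; under eq_bigr do rewrite mxE sqrrN. Qed.

Lemma enormZ (l : R) x : enorm (l *: x) = `|l| * enorm x.
Proof.
apply/eqP; rewrite -(eqrXn2 (ltn0Sn 1)) ?mulr_ge0 ?enorm_ge0//.
rewrite exprMn !sqr_enorm mulr_sumr real_normK ?num_real//.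
by apply/eqP/eq_bigr => i _; rewrite mxE exprMn.
Qed.

(** The squared norm of [b^2 x - c y] equals [b^2 (a^2 b^2 - c^2)], so [c^2 <= a^2 b^2] once
    [b > 0]; if [b = 0] then [y] vanishes. *)
Lemma cauchy_schwarz x y :
  \sum_(i < m) x ord0 i * y ord0 i <= enorm x * enorm y.
Proof.
set c := \sum_(i < m) _; set a := enorm x; set b := enorm y.
have : 0 <= \sum_(i < m) (b ^+ 2 * x ord0 i - c * y ord0 i) ^+ 2.
  by apply: sumr_ge0 => i _; exact: sqr_ge0.
rewrite [X in _ <= X](_ : _ = b ^+ 2 * (a ^+ 2 * b ^+ 2 - c ^+ 2)); last first.
  transitivity (\sum_(i < m) (b ^+ 4 * x ord0 i ^+ 2 -
      (b ^+ 2 * c *+ 2) * (x ord0 i * y ord0 i) + c ^+ 2 * y ord0 i ^+ 2)).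
    by apply: eq_bigr => i _; ring.
  rewrite big_split sumrB/= -!mulr_sumr -!sqr_enorm -/a -/b -/c; ring.
have a0 : 0 <= a by exact: enorm_ge0.
have : 0 <= b by exact: enorm_ge0.
rewrite le_eqVlt => /predU1P[b0 _|b0].
  have y0 i : y ord0 i = 0.
    move: (sqr_enorm y); rewrite -/b -b0 expr0n/= => /esym/eqP.
    rewrite psumr_eq0; last by move=> j _; exact: sqr_ge0.
    by move=> /allP/(_ i (mem_index_enum _)); rewrite sqrf_eq0 => /eqP.
  by rewrite /c -b0 mulr0 big1// => i _; rewrite y0 mulr0.
rewrite pmulr_rge0 ?exprn_gt0// subr_ge0 -exprMn => cab.
have [c0|/ltW c0] := leP 0 c; last by rewrite (le_trans c0)// mulr_ge0// ltW.
by rewrite -(ler_pXn2r (ltn0Sn 1)) ?nnegrE// mulr_ge0// ltW.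
Qed.

Lemma enormD x y : enorm (x + y) <= enorm x + enorm y.
Proof.
apply: enorm_le; first by rewrite addr_ge0 ?enorm_ge0.
rewrite sqrrD !sqr_enorm.
under eq_bigr do rewrite mxE sqrrD.
by rewrite !big_split/= lerD2r lerD2l mulr2n lerD// cauchy_schwarz.
Qed.

Lemma norm_le_enorm x : `|x| <= enorm x.
Proof.
rewrite [leLHS]/Num.norm/= mx_normrE; apply/bigmax_leP; split; first exact: enorm_ge0.
move=> [i j] _ /=; rewrite (ord1 i).
rewrite -(ler_pXn2r (ltn0Sn 1)) ?nnegrE ?enorm_ge0// sqr_enorm.
rewrite real_normK ?num_real// (bigD1 j)//= lerDl.
by apply: sumr_ge0 => k _; exact: sqr_ge0.
Qed.

(** The crude constant [m + 1] replaces the square root of [m]: it is positive for every [m], so a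
    radius may be divided by it. *)
Lemma enorm_le_norm x : enorm x <= m.+1%:R * `|x|.
Proof.
apply: enorm_le; first by rewrite mulr_ge0.
have xi i : x ord0 i ^+ 2 <= `|x| ^+ 2.
  rewrite -(@real_normK _ (x ord0 i)) ?num_real// ler_pXn2r ?nnegrE//.
  by rewrite [leRHS]/Num.norm/= mx_normrE; apply/bigmax_geP; right; exists (ord0, i).
apply: (le_trans (ler_sum _ (fun i _ => xi i))).
rewrite sumr_const card_ord -[leLHS]mulr_natl exprMn; apply: ler_wpM2r.
  exact: sqr_ge0.
by rewrite -natrX ler_nat (@leq_trans m.+1)// leq_pmulr.
Qed.

Lemma edistance_ge0 x y : 0 <= edistance x y. Proof. exact: enorm_ge0. Qed.

Lemma edistancexx x : edistance x x = 0.
Proof. by rewrite /edistance subrr enorm0. Qed.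

Lemma edistanceC x y : edistance x y = edistance y x.
Proof. by rewrite /edistance -opprB enormN. Qed.

Lemma edistance_triangle y x z :
  edistance x z <= edistance x y + edistance y z.
Proof.
rewrite /edistance (_ : x - z = (x - y) + (y - z)) ?enormD//.
by rewrite addrA subrK.
Qed.

Lemma edistance_eq0 x y : edistance x y = 0 -> x = y.
Proof.
move=> xy; apply/eqP; rewrite -subr_eq0 -normr_eq0 eq_le normr_ge0 andbT.
by rewrite (le_trans (norm_le_enorm _))// -/(edistance x y) xy.
Qed.

Lemma enorm_le_edistance x y : enorm x <= enorm y + edistance x y.
Proof. by rewrite /edistance -{1}(subrK y x) addrC enormD. Qed.

(* Translates between the library topology (sup norm) and the Euclidean one. *)
Lemma nbhs_edistance x (P : set 'rV[R]_m) :
  nbhs x P <-> exists2 e, 0 < e & forall y, edistance x y < e -> P y.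
Proof.
split=> [/nbhs_normP[e /= e0 eP]|[e e0 eP]].
  exists e => // y xy; apply: eP.
  by rewrite /ball_/= (le_lt_trans (norm_le_enorm _)).
apply/nbhs_ballP; exists (e / m.+1%:R) => /=; first by rewrite divr_gt0.
move=> y; rewrite -ball_normE /= => xy; apply: eP; rewrite (le_lt_trans (enorm_le_norm _))//.
by rewrite mulrC -ltr_pdivlMr.
Qed.

End EuclideanNorm.

(** * Limits of points along an ultrafilter *)

Section UltraLimits.
Context {R : realType} {m : nat} {T : Type}.
Variable F : set_system T.
Context {UF : UltraFilter F}.
Implicit Types (x : T -> 'rV[R]_m) (P : set T).

Lemma ultra_contra P : (F (~` P) -> False) -> F P.
Proof. by have [//|FP /(_ FP)] := in_ultra_setVsetC P UF. Qed.

Definition ulim x l := forall e : R, 0 < e -> F [set t | edistance (x t) l < e].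

(** The values lie in a compact sup-norm ball, so the image of [F] has a cluster point. An
    ultrafilter converges to its cluster points: otherwise [F] would contain the set of indices
    whose values avoid some ball around [l]. *)
Lemma ulim_exists x (C : R) :
  F [set t | enorm (x t) <= C] -> exists l, ulim x l.
Proof.
move=> FC; pose K := [set y : 'rV[R]_m | `|y| <= C].
have cK : compact K.
  apply: bounded_closed_compact.
    exists C; split; first exact: num_real.
    by move=> M CM y /= yC; exact: (le_trans yC (ltW CM)).
  rewrite (_ : K = (fun y => `|y|) @^-1` [set z | z <= C])//.
  by apply: closed_comp => [y _|]; [exact: norm_continuous|exact: closed_le].
have [] := cK (x @ F).
  by apply: filterS FC => t; exact: (le_trans (norm_le_enorm _)).
move=> l [_ clF]; exists l => e e0; apply: ultra_contra => /= Fe.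
have [] := clF [set y | ~ edistance y l < e] [set y | edistance y l < e] Fe.
  by apply/nbhs_edistance; exists e => // y; rewrite edistanceC.
by move=> y [].
Qed.

End UltraLimits.

(** * The Hausdorff distance on nonempty bounded sets *)

Section HausdorffDistance.
Context {R : realType} {m : nat}.
Implicit Types (x y : 'rV[R]_m) (A B C : set 'rV[R]_m) (e : R).

(** One half of the Hausdorff distance, free of suprema and infima. Being nearby in both directions
    follows from [hausdorff_dist A B < e] but only gives back [<= e]. *)
Definition nearby A B e := forall a, A a -> exists2 b, B b & edistance a b < e.

Definition nebounded A := A !=set0 /\ exists M, forall x, A x -> enorm x <= M.

Lemma sub_nearby A B e : 0 < e -> A `<=` B -> nearby A B e.
Proof. by move=> e0 AB x /AB Bx; exists x => //; rewrite edistancexx. Qed.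

Lemma nearby_trans A B C e f :
  nearby A B e -> nearby B C f -> nearby A C (e + f).
Proof.
move=> AB BC x /AB[y /BC[z Cz yz] xy]; exists z => //.
by rewrite (le_lt_trans (edistance_triangle y _ _))// ltrD.
Qed.

Lemma nearby_le A B e f : e <= f -> nearby A B e -> nearby A B f.
Proof. by move=> ef AB x /AB[y By xy]; exists y => //; exact: lt_le_trans ef. Qed.

Lemma hausdorff_lt A B e :
  (hausdorff_dist A B < e%:E)%E -> nearby A B e /\ nearby B A e.
Proof.
rewrite /hausdorff_dist gt_max => /andP[AB BA]; split=> [a Aa|b Bb].
- have : (ereal_inf [set (edistance a b)%:E | b in B] < e%:E)%E.
    by apply: le_lt_trans AB; apply: ereal_sup_ubound; exists a.
  by move=> /ereal_inf_lt[_ [b Bb <-]]; rewrite lte_fin; exists b.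
- have : (ereal_inf [set (edistance a b)%:E | a in A] < e%:E)%E.
    by apply: le_lt_trans BA; apply: ereal_sup_ubound; exists b.
  by move=> /ereal_inf_lt[_ [a Aa <-]]; rewrite lte_fin edistanceC; exists a.
Qed.

Lemma hausdorff_le A B e : nearby A B e -> nearby B A e ->
  (hausdorff_dist A B <= e%:E)%E.
Proof.
move=> AB BA; rewrite /hausdorff_dist ge_max; apply/andP; split.
- apply: ge_ereal_sup => _ [a /AB[b Bb ab] <-].
  by apply: ge_ereal_inf; exists (edistance a b)%:E; [exists b|rewrite lee_fin ltW].
- apply: ge_ereal_sup => _ [b /BA[a Aa ab] <-].
  apply: ge_ereal_inf; exists (edistance a b)%:E; [by exists a|].
  by rewrite lee_fin edistanceC ltW.
Qed.

Lemma hausdorff_ge0 A B : A !=set0 -> (0 <= hausdorff_dist A B)%E.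
Proof.
move=> [a Aa]; rewrite /hausdorff_dist le_max; apply/orP; left.
apply: (@le_trans _ _ (ereal_inf [set (edistance a b)%:E | b in B])).
  by apply: le_ereal_inf_tmp => _ [b Bb <-]; rewrite lee_fin edistance_ge0.
by apply: ereal_sup_ubound; exists a.
Qed.

Lemma hausdorffC A B : hausdorff_dist A B = hausdorff_dist B A.
Proof.
rewrite /hausdorff_dist maxC; apply: (congr2 Order.max); congr ereal_sup.
  by apply: eq_imagel => x _; congr ereal_inf; apply: eq_imagel => y _; rewrite edistanceC.
by apply: eq_imagel => x _; congr ereal_inf; apply: eq_imagel => y _; rewrite edistanceC.
Qed.

(** [fine] turns infinite values into 0, so this is the true distance only where finiteness is
    known, as for [nebounded] sets. *)
Definition hd A B : R := fine (hausdorff_dist A B).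

Lemma hdC A B : hd A B = hd B A. Proof. by rewrite /hd hausdorffC. Qed.

Lemma nebounded_nearby A B : nebounded A -> nebounded B -> exists e, nearby A B e.
Proof.
move=> [_ [M AM]] [[b Bb] [N BN]]; exists (M + N + 1) => a Aa; exists b => //.
rewrite /edistance (le_lt_trans (enormD _ _))// enormN ltr_pwDr// lerD//.
  exact: AM.
exact: BN.
Qed.

Lemma hdE A B : nebounded A -> nebounded B -> (hd A B)%:E = hausdorff_dist A B.
Proof.
move=> bA bB; rewrite /hd fineK//.
have [e1 AB] := nebounded_nearby bA bB; have [e2 BA] := nebounded_nearby bB bA.
rewrite ge0_fin_numE; last by apply: hausdorff_ge0; case: bA.
apply: (@le_lt_trans _ _ (Num.max e1 e2)%:E); last by rewrite ltry.
by apply: hausdorff_le; [apply: nearby_le AB|apply: nearby_le BA];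
  rewrite le_max lexx ?orbT.
Qed.

Lemma hd_ge0 A B : 0 <= hd A B.
Proof.
have [->|/set0P A0] := eqVneq A set0; last by rewrite fine_ge0// hausdorff_ge0.
rewrite hdC; have [->|/set0P B0] := eqVneq B set0; last first.
  by rewrite fine_ge0// hausdorff_ge0.
(* For two empty sets both suprema are minus infinity, and [fine] returns 0. *)
by rewrite /hd /hausdorff_dist !image_set0 ereal_sup0 maxxx.
Qed.

Lemma hd_lt A B e : nebounded A -> nebounded B -> hd A B < e -> nearby A B e /\ nearby B A e.
Proof. by move=> bA bB ABe; apply: hausdorff_lt; rewrite -hdE// lte_fin. Qed.

Lemma hd_le A B e : nebounded A -> nebounded B ->
  (forall f, e < f -> nearby A B f) -> (forall f, e < f -> nearby B A f) ->
  hd A B <= e.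
Proof.
move=> bA bB AB BA; apply/ler_addgt0Pr => f f0.
rewrite -lee_fin hdE//; apply: hausdorff_le; [apply: AB|apply: BA];
  by rewrite ltrDl.
Qed.

Lemma hd_triangle B A C : nebounded A -> nebounded B -> nebounded C ->
  hd A C <= hd A B + hd B C.
Proof.
move=> bA bB bC; apply/ler_addgt0Pr => e e0.
have [|AB BA] := @hd_lt A B (hd A B + e / 2) bA bB.
  by rewrite ltrDl divr_gt0.
have [|BC CB] := @hd_lt B C (hd B C + e / 2) bB bC.
  by rewrite ltrDl divr_gt0.
have -> : hd A B + hd B C + e = (hd A B + e / 2) + (hd B C + e / 2) by field.
apply: hd_le => // f /ltW ef.
  exact: (nearby_le ef (nearby_trans AB BC)).
by rewrite addrC in ef; exact: (nearby_le ef (nearby_trans CB BA)).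
Qed.

Lemma hdxx A : nebounded A -> hd A A = 0.
Proof.
move=> bA; apply/eqP; rewrite eq_le hd_ge0 andbT.
by apply: hd_le => // f f0; exact: sub_nearby.
Qed.

Lemma hd0_nearby A B e : nebounded A -> nebounded B -> hd A B = 0 -> 0 < e -> nearby A B e.
Proof. by move=> bA bB AB0 e0; have [|] := @hd_lt A B e bA bB; rewrite ?AB0. Qed.

End HausdorffDistance.

(** * Monotonicity and left continuity of the cuts of a fuzzy set *)

Section Cuts.
Context {R : realType} {m : nat}.
Implicit Types (u v : 'rV[R]_m -> R) (a b e : R).

Lemma acutE u a : 0 < a -> acut u a = [set x | a <= u x].
Proof. by move=> a0; rewrite /acut gt_eqF. Qed.

Lemma acut_subset u a b : 0 <= a <= b -> acut u b `<=` acut u a.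
Proof.
move=> /andP[]; rewrite le_eqVlt => /predU1P[<-|a0] ab; last first.
  by rewrite !acutE// ?(lt_le_trans a0)// => x /=; exact: le_trans.
rewrite le_eqVlt in ab; move: ab => /predU1P[<-//|b0].
rewrite acutE// /acut eqxx => x /= bx.
by apply: subset_closure => /=; rewrite (lt_le_trans _ bx).
Qed.

Lemma acut_nebounded u a : FB R m u -> 0 <= a <= 1 -> nebounded (acut u a).
Proof.
move=> [_ [x ux] _ [M uM]] /andP[a0 a1]; split.
  by exists x; apply: (@acut_subset u a 1); rewrite ?a0// acutE//= ux.
by exists M => y uay; apply: uM; apply: acut_subset uay; rewrite lexx.
Qed.

Lemma usc_ulim {T : Type} (F : set_system T) {UF : UltraFilter F}
    (x : T -> 'rV[R]_m) l u a :
  upper_semicontinuous u -> ulim F x l -> F [set t | a <= u (x t)] -> a <= u l.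
Proof.
move=> uscu xl ua; rewrite leNgt; apply/negP => ula.
have /nbhs_edistance[e e0 eP] := uscu _ _ ula.
have [t /= [xle]] := @filter_ex _ F _ _ (filterI (xl e e0) ua).
by rewrite leNgt eP// edistanceC.
Qed.

(** Otherwise there are points [x n] with [u (x n) >= a - d n], [d n] tending to 0, at distance at
    least [e] from [acut u a]. The support is bounded, so they have a limit along an ultrafilter;
    upper semicontinuity puts it in [acut u a], a contradiction. *)
Lemma acut_left_nearby u a e : FB R m u -> 0 < a -> 0 < e ->
  exists2 d, 0 < d < a & forall b, a - d < b -> nearby (acut u b) (acut u a) e.
Proof.
move=> FBu a0 e0; apply: contrapT => /forall2NP nP.
have [G [UG Goo]] := ultraFilterLemma eventually_filter.
(* With [n + 2] in the denominator, [a - d n] is positive already for [n = 0], and the cut at that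
   level is a superlevel set, not a closure. *)
pose d n : R := a / n.+2%:R.
have d_gt0 n : 0 < d n by rewrite divr_gt0.
have d_lt n : d n < a by rewrite /d ltr_pdivrMr// ltr_pMr// ltr1n.
have /choice[x xP] : forall n, exists x,
    [/\ 0 < a - d n, a - d n <= u x & forall y, acut u a y -> e <= edistance x y].
  move=> n; have [|/existsNP[b /not_implyP[db /existsNP[x]]]] := nP (d n).
    by rewrite d_gt0 d_lt.
  move=> /not_implyP[ubx /forall2NP far]; exists x.
  have ad0 : 0 < a - d n by rewrite subr_gt0.
  split=> //.
    by move: ubx; rewrite acutE/=; [apply: le_trans; exact: ltW|exact: lt_trans db].
  by move=> y uy; rewrite leNgt; apply/negP; case: (far y).
have [_ _ uscu [M uM]] := FBu.
have [|l xl] := @ulim_exists _ _ _ G UG x M.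
  apply: filterE => n; apply: uM; have [ad ux _] := xP n.
  by apply: (@acut_subset u 0 (a - d n)); rewrite ?lexx ?ltW// acutE.
have ul : acut u a l.
  rewrite acutE//=; apply/ler_addgt0Pr => f f0; rewrite -lerBlDr.
  apply: (usc_ulim uscu xl); apply: Goo.
  have [N _ Nf] : \forall n \near \oo, d n < f.
    near=> n; rewrite /d ltr_pdivrMr// mulrC -ltr_pdivrMr//.
    apply: (@lt_trans _ _ n%:R); last by rewrite ltr_nat ltnS leqnSn.
    by near: n; exact: nbhs_infty_gtr.
  exists N => // n Nn /=; have [_ + _] := xP n; apply: le_trans.
  by rewrite lerD2l lerN2 ltW// Nf.
have [n /= xln] := @filter_ex _ G _ _ (xl e e0).
by have [_ _ /(_ _ ul)] := xP n; rewrite leNgt xln.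
Unshelve. all: by end_near. Qed.

Lemma acut_left_hd u a e : FB R m u -> 0 < a <= 1 -> 0 < e ->
  exists2 d, 0 < d < a &
    forall b, a - d < b <= a -> hd (acut u b) (acut u a) <= e.
Proof.
move=> FBu /andP[a0 a1] e0; have [d /andP[d0 da] dP] := acut_left_nearby FBu a0 e0.
exists d; rewrite ?d0// => b /andP[db ba].
have b0 : 0 < b by rewrite (lt_trans _ db)// subr_gt0.
apply: hd_le => [||f ef|f ef].
- by apply: acut_nebounded; rewrite ?(ltW b0) ?(le_trans ba).
- by apply: acut_nebounded; rewrite ?(ltW a0).
- by apply: nearby_le (ltW ef) _; exact: dP.
- by apply: sub_nearby; [exact: lt_trans ef|apply: acut_subset; rewrite ltW].
Qed.

End Cuts.

(** * Measurability of left-continuous functions *)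

Section LeftContinuous.
Context {R : realType}.
Implicit Types (f : R -> R).

Definition left_continuous f := forall x e, 0 < e -> exists2 d, 0 < d &
  forall y, x - d < y <= x -> `|f x - f y| <= e.

(** The function is constant on each interval [](k - 1) / c, k / c]], so a preimage is a countable
    union of such intervals. *)
Lemma measurable_ceil_comp (F : int -> R) (c : R) : 0 < c ->
  measurable_fun setT (fun x : measurableTypeR R => F (Num.ceil (c * x))).
Proof.
move=> c0 _ Y mY; rewrite setTI.
rewrite (_ : _ @^-1` Y = \bigcup_(k : int)
    [set x | Y (F k) /\ x \in `](k - 1)%:~R / c, k%:~R / c]]); last first.
  apply/seteqP; split=> x /=.
    exists (Num.ceil (c * x)) => //; split=> //.
    rewrite in_itv/= ltr_pdivrMr// ler_pdivlMr// mulrC; exact: ceil_itv.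
  move=> [k _ [Yk]]; rewrite in_itv/= ltr_pdivrMr// ler_pdivlMr// mulrC.
  by move/ceil_def => ->.
apply: countable_bigcupT_measurable => // k.
have [Yk|Yk] := pselect (Y (F k)).
  rewrite (_ : [set x | _] = `](k - 1)%:~R / c, k%:~R / c]%classic)//.
  by apply/seteqP; split=> x //= [].
by rewrite (_ : [set x | _] = set0)//; apply/seteqP; split=> x // [].
Qed.

(* [f] is the pointwise limit of its left discretizations on finer and finer
   grids. *)
Lemma left_continuous_measurable f :
  left_continuous f -> measurable_fun (setT : set (measurableTypeR R)) f.
Proof.
move=> lcf.
(* The sample point is the last grid point strictly below [x]; subtracting 1 from the ceiling keeps
   it on the left, at distance at most [1 / (n + 1)]. *)
pose g n (x : measurableTypeR R) : R :=
  f ((Num.ceil (n.+1%:R * x) - 1)%:~R / n.+1%:R).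
apply: (@measurable_fun_cvg _ _ _ _ g) => [n|x _].
  exact: (measurable_ceil_comp (fun k => f ((k - 1)%:~R / n.+1%:R))).
apply/cvgrPdist_le => e e0; have [d d0 dP] := lcf x e e0.
near=> n; apply: dP.
have n0 : 0 < n.+1%:R :> R by [].
rewrite ltr_pdivlMr// ler_pdivrMr//.
have /andP[c1 c2] := ceil_itv (n.+1%:R * x).
rewrite (mulrC x) (ltW c1) andbT.
have dn : n.+1%:R^-1 < d by near: n; exact: (near_infty_natSinv_lt (PosNum d0)).
have dN : 1 < d * n.+1%:R by rewrite -ltr_pdivrMr// div1r.
rewrite mulrBl intrB.
by move: c2 dN; move: (_%:~R) => k; lra.
Unshelve. all: by end_near. Qed.

End LeftContinuous.

(** * The L^p norm on the real line: translations and dominated convergence *)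

Section LpNorm.
Context {R : realType}.
Variables (p : R).
Hypothesis p1 : 1 <= p.
Implicit Types (f g : R -> R).
Local Notation mu := (@lebesgue_measure R).

Let p0 : 0 < p. Proof. exact: lt_le_trans p1. Qed.
Let ip0 : 0 <= p^-1. Proof. by rewrite invr_ge0 ltW. Qed.
Let p_neq0 : p != 0. Proof. by rewrite gt_eqF. Qed.

(** The norm is over the whole line, so that translation is an isometry; cut distances will be
    extended by 0 outside []0, 1]]. *)
Definition LpN f : \bar R := 'N[mu]_p%:E[EFin \o f].

Definition mfunR f := measurable_fun (setT : set (measurableTypeR R)) f.

Lemma mfunR_powR f : mfunR f ->
  measurable_fun (setT : set (measurableTypeR R)) (fun x => (f x `^ p)%:E).
Proof.
move=> mf; apply/measurable_EFinP.
exact: (measurableT_comp (measurable_powR p) mf).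
Qed.

Lemma LpNE f : (forall x, 0 <= f x) ->
  LpN f = ((\int[mu]_x (f x `^ p)%:E) `^ p^-1)%E.
Proof.
move=> f0; rewrite /LpN unlock; congr (_ `^ _)%E.
by apply: eq_integral => x _ /=; rewrite ger0_norm.
Qed.

Lemma LpN_le f g : mfunR f -> mfunR g -> (forall x, 0 <= f x <= g x) ->
  (LpN f <= LpN g)%E.
Proof.
move=> mf mg fg.
have f0 x : 0 <= f x by have /andP[] := fg x.
have g0 x : 0 <= g x by have /andP[/le_trans + le] := fg x; apply.
rewrite !LpNE//; apply: (gt0_ler_poweR ip0).
- by rewrite in_itv/= leey integral_ge0// => x _; rewrite lee_fin powR_ge0.
- by rewrite in_itv/= leey integral_ge0// => x _; rewrite lee_fin powR_ge0.
apply: ge0_le_integral => //.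
- by move=> x _; rewrite lee_fin powR_ge0.
- exact: mfunR_powR.
- exact: mfunR_powR.
- move=> x _; rewrite lee_fin ge0_ler_powR ?nnegrE ?(ltW p0)//.
  by have /andP[] := fg x.
Qed.

Lemma LpND f g : mfunR f -> mfunR g ->
  (LpN (fun x => f x + g x)%R <= LpN f + LpN g)%E.
Proof. by move=> mf mg; exact: minkowski_EFin. Qed.

Lemma mfunR_shift h f : mfunR f -> mfunR (fun x => f (x + h)).
Proof.
move=> mf; apply: (measurableT_comp mf).
by apply: measurable_funD => //; exact: measurable_cst.
Qed.

Let measurable_shift h : measurable_fun setT
  (fun x : measurableTypeR R => x + h : measurableTypeR R).
Proof. by apply: measurable_funD => //; exact: measurable_cst. Qed.

(** By uniqueness of the Lebesgue measure it suffices to compare lengths of half-open intervals: the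
    preimage of []a, b]] is []a - h, b - h]]. *)
Lemma lebesgue_measure_shift h (A : set R) : measurable A ->
  pushforward mu (fun x : measurableTypeR R => x + h : measurableTypeR R) A = mu A.
Proof.
move=> mA; apply/esym.
pose nu := measure_function.measure_function_pushforward__canonical__measure_function_Measure
  mu (measurable_shift h).
apply: (@lebesgue_measure_unique R nu) => //= _ [[a b]] _ <-.
have E : (fun x : R => x + h) @^-1` `]a, b]%classic = `]a - h, b - h]%classic.
  by apply/funext => x; rewrite /= !in_itv/= ltrBlDr lerBrDr.
rewrite /pushforward /= [X in _ = lebesgue_measure X]E.
rewrite !lebesgue_measure_itv/= !lte_fin ltrD2r.
by case: ifPn => // _; rewrite -!EFinB; congr EFin; ring.
Qed.

Lemma LpN_shift h f : mfunR f -> LpN (fun x => f (x + h)) = LpN f.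
Proof.
move=> mf; rewrite /LpN unlock; congr (_ `^ _)%E.
rewrite -[LHS](@ge0_integral_pushforward _ _ _ _ _ _ (measurable_shift h) mu setT
  (fun x => (`|(f x)%:E| `^ p)%E))//.
- by apply: eq_measure_integral => A mA _; exact: lebesgue_measure_shift.
- apply: (@measurableT_comp _ _ _ _ _ _ (fun x => x `^ p)%E).
    exact: measurable_poweR.
  by apply/measurableT_comp => //; exact/measurable_EFinP.
- by move=> x _; exact: poweR_ge0.
Qed.

Lemma LpN_itv (a b c : R) : a <= b -> 0 <= c ->
  LpN (fun x => c * \1_`]a, b]%classic x) = (c * (b - a) `^ p^-1)%:E.
Proof.
move=> ab c0; rewrite LpNE; last by move=> x; rewrite mulr_ge0.
under eq_integral => x _.
  rewrite powRM// (_ : _ (\1_`]a, b]%classic x) p = \1_`]a, b]%classic x); last first.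
    by rewrite indicE; case: (_ \in _); rewrite ?powR1 ?powR0.
  rewrite EFinM; over.
rewrite ge0_integralZl_EFin//; last 2 first.
- by apply/measurable_EFinP; exact: measurable_indic.
- exact: powR_ge0.
rewrite integral_indic// setIT/= lebesgue_measure_itv/= lte_fin.
move: ab; rewrite le_eqVlt => /predU1P[->|ab].
  by rewrite ltxx mule0 subrr powR0 ?invr_neq0// mulr0 poweR0r// invr_neq0.
rewrite ab -EFinB -EFinM poweR_EFin powRM ?powR_ge0 ?subr_ge0 ?ltW//.
by rewrite -powRrM divff// powRr1.
Qed.

Lemma LpN_bounded f (c : R) : mfunR f -> 0 <= c ->
  (forall x, 0 <= f x <= c * \1_`]0, 1]%classic x) -> (LpN f <= c%:E)%E.
Proof.
move=> mf c0 fc; apply: (@le_trans _ _ (LpN (fun x => c * \1_`]0, 1]%classic x))).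
  apply: LpN_le => //.
  by apply: measurable_funM; [exact: measurable_cst|exact: measurable_indic].
by rewrite LpN_itv// subr0 powR1 mulr1.
Qed.

(** Dominated convergence applied to the [p]-th powers, which are dominated by [c^p] on []0, 1]]. *)
Lemma LpN_cvg0 (f : nat -> R -> R) (c : R) : (forall n, mfunR (f n)) -> 0 <= c ->
  (forall n x, 0 <= f n x <= c * \1_`]0, 1]%classic x) ->
  (forall x, f ^~ x @ \oo --> 0) -> 
  forall e, 0 < e -> \forall n \near \oo, (LpN (f n) <= e%:E)%E.
Proof.
move=> mf c0 fc f0.
have fge0 n x : 0 <= f n x by have /andP[] := fc n x.
have mg : measurable_fun setT
    (fun x : measurableTypeR R => (c `^ p * \1_`]0, 1]%classic x)%:E).
  apply/measurable_EFinP.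
  by apply: measurable_funM; [exact: measurable_cst|exact: measurable_indic].
have [] := @dominated_convergence _ _ _ mu setT measurableT
  (fun n x => (f n x `^ p)%:E) (cst 0%E) (fun x => (c `^ p * \1_`]0, 1]%classic x)%:E).
- by move=> n; exact: mfunR_powR (mf n).
- exact: measurable_cst.
- apply: aeW => x _; apply: cvg_EFin; first exact: nearW.
  apply/cvgrPdist_le => e e0.
  have e'0 : 0 < e `^ p^-1 by rewrite powR_gt0.
  have /cvgrPdist_le/(_ _ e'0) := f0 x; apply: filterS => n.
  rewrite !sub0r !normrN !ger0_norm ?powR_ge0// => fe.
  rewrite (le_trans (@ge0_ler_powR _ p (ltW p0) _ _ _ _ fe)) ?nnegrE ?powR_ge0//.
  by rewrite -powRrM mulVf// powRr1// ltW.
- apply/integrableP; split=> //.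
  under eq_integral => x _ do rewrite gee0_abs ?lee_fin ?mulr_ge0 ?powR_ge0// EFinM.
  rewrite ge0_integralZl_EFin ?powR_ge0//; last first.
    by apply/measurable_EFinP; exact: measurable_indic.
  by rewrite integral_indic// setIT/= lebesgue_measure_itv/= lte01 -EFinB -EFinM ltry.
- apply: aeW => x n _; rewrite gee0_abs ?lee_fin ?powR_ge0//.
  have /andP[_] := fc n x; rewrite indicE.
  case: (_ \in _); rewrite ?mulr1 ?mulr0 => le.
    by rewrite ge0_ler_powR ?nnegrE ?(ltW p0).
  by rewrite (_ : f n x = 0) ?powR0//; apply/eqP; rewrite eq_le le fge0.
move=> _ _; rewrite integral0 => /fine_cvgP[fin cv] e e0.
have ep0 : 0 < e `^ p by rewrite powR_gt0.
have /cvgrPdist_le/(_ _ ep0) := cv.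
apply: filterS2 fin => n /= fin; rewrite sub0r normrN => le.
have -> : e%:E = ((e `^ p)%:E `^ p^-1)%E.
  by rewrite poweR_EFin -powRrM divff// powRr1// ltW.
rewrite LpNE//.
apply: (gt0_ler_poweR ip0).
- by rewrite in_itv/= leey integral_ge0// => x _; rewrite lee_fin powR_ge0.
- by rewrite in_itv/= leey lee_fin powR_ge0.
- by rewrite -(fineK fin) lee_fin (le_trans (ler_norm _)).
Qed.

(** The left endpoint is a null set, so nothing is asked of [g] there. This discards level 0, where
    the cut is a closure, from all later estimates. *)
Lemma integral_LpN (a : R) (g : R -> \bar R) f : mfunR f ->
  (forall x, 0 <= f x) -> (forall x, ~ (a < x <= 1) -> f x = 0) ->
  (forall x, a < x <= 1 -> g x = (f x)%:E) ->
  ((\int[mu]_(x in `[a, 1%R]) (g x `^ p)) `^ p^-1)%E = LpN f.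
Proof.
move=> mf f0 f_out fg; rewrite LpNE//; congr (_ `^ _)%E.
have mfp : measurable_fun (setT : set (measurableTypeR R)) (fun x => (f x `^ p)%:E).
  exact: mfunR_powR.
have E : {in `]a, 1%R]%classic, (fun x => (f x `^ p)%:E) =1 (fun x => (g x `^ p)%E)}.
  by move=> x; rewrite inE/= in_itv/= => xa; rewrite fg.
rewrite -integral_itv_obnd_cbnd; last first.
  by apply: eq_measurable_fun E _; exact: measurable_funTS.
transitivity (\int[mu]_(x in `]a, 1%R]) (f x `^ p)%:E)%E.
  by apply: eq_integral => x /E.
rewrite integral_mkcond; apply: eq_integral => x _.
rewrite patchE mem_setE in_itv/=; case: ifPn => // /negP xa.
by rewrite f_out// powR0.
Qed.

End LpNorm.

(** * The distance between two families of cuts as a function of the level *)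

Section CutDistance.
Context {R : realType} {m : nat}.
Implicit Types (A B C : R -> set 'rV[R]_m) (u v w : 'rV[R]_m -> R) (a b c h : R).

(** The interval []c, 1]] is open on the left and closed on the right, so extending by 0 keeps left
    continuity. The cutoff [c] is 0 for [d_p] and [h] for the modulus at shift [h]. *)
Definition cutdist c A B a : R := if c < a <= 1 then hd (A a) (B a) else 0.

Definition hd_left_continuous c A := forall a, c < a <= 1 -> nebounded (A a) /\
  forall e, 0 < e -> exists2 d, 0 < d &
    forall b, a - d < b <= a -> c < b -> hd (A b) (A a) <= e.

Lemma cutdist_ge0 c A B a : 0 <= cutdist c A B a.
Proof. by rewrite /cutdist; case: ifP => // _; exact: hd_ge0. Qed.

Lemma cutdistC c A B : cutdist c A B = cutdist c B A.
Proof. by apply/funext => a; rewrite /cutdist hdC. Qed.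

Lemma cutdist_triangle c B A C a : hd_left_continuous c A ->
  hd_left_continuous c B -> hd_left_continuous c C ->
  cutdist c A C a <= cutdist c A B a + cutdist c B C a.
Proof.
move=> lA lB lC; rewrite /cutdist; case: ifP => [ca|]; last by rewrite addr0.
by apply: hd_triangle; [have [] := lA a ca|have [] := lB a ca|have [] := lC a ca].
Qed.

Lemma hd_left_continuous_le c c' A : c <= c' -> hd_left_continuous c A -> hd_left_continuous c' A.
Proof.
move=> cc lA a /andP[ca a1]; have [|bA lcA] := lA a; first by rewrite a1 (le_lt_trans cc).
split=> // e /lcA[d d0 dP]; exists d => // b bd cb.
by apply: dP => //; exact: le_lt_trans cb.
Qed.

(** Up to [c] and beyond 1 the function is 0 just to the left. In between, replacing [A a] by [A b]
    and [B a] by [B b] costs at most [e / 2] each. *)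
Lemma cutdist_left_continuous c A B :
  hd_left_continuous c A -> hd_left_continuous c B -> left_continuous (cutdist c A B).
Proof.
move=> lA lB a e e0; have [ac|ca] := leP a c.
  exists 1 => // b /andP[_ ba].
  by rewrite /cutdist !ltNge (le_trans ba ac) ac/= subrr normr0 ltW.
have [a1|a1] := leP a 1; last first.
  exists (a - 1); first by rewrite subr_gt0.
  move=> b; rewrite opprB addrCA subrr addr0 => /andP[b1 _].
  by rewrite /cutdist !(andbC (c < _)) !(leNgt _ 1) b1 a1/= subrr normr0 ltW.
have e2 : 0 < e / 2 by rewrite divr_gt0.
have [|bA lcA] := lA a; first by rewrite ca.
have [|bB lcB] := lB a; first by rewrite ca.
have [d1 d10 P1] := lcA _ e2; have [d2 d20 P2] := lcB _ e2.
(* The bound [a - c] keeps [b] above the cutoff. *)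
exists (Num.min (Num.min d1 d2) (a - c)).
  by rewrite !lt_min d10 d20 subr_gt0.
move=> b /andP[]; rewrite ltrBlDr -ltrBlDl !lt_min -andbA => /and3P[b1 b2 b3 ba].
have cb : c < b by move: b3; lra.
have b_1 : b <= 1 by exact: le_trans a1.
have [|bAb _] := lA b; first by rewrite cb.
have [|bBb _] := lB b; first by rewrite cb.
have HA : hd (A b) (A a) <= e / 2 by apply: P1 => //; rewrite ba andbT; move: b1; lra.
have HB : hd (B b) (B a) <= e / 2 by apply: P2 => //; rewrite ba andbT; move: b2; lra.
rewrite /cutdist ca a1 cb b_1/=.
have t1 := hd_triangle bA bAb bB; have t2 := hd_triangle bAb bBb bB.
have t3 := hd_triangle bAb bA bBb; have t4 := hd_triangle bA bB bBb.
rewrite (hdC (A a) (A b)) in t1; rewrite (hdC (B a) (B b)) in t4.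
by rewrite ler_norml; apply/andP; split; lra.
Qed.

Lemma cutdist_mfun c A B : hd_left_continuous c A -> hd_left_continuous c B ->
  mfunR (cutdist c A B).
Proof.
by move=> lA lB; apply: left_continuous_measurable; exact: cutdist_left_continuous.
Qed.

Lemma hd_left_continuous_acutB u h : FB R m u -> 0 <= h ->
  hd_left_continuous h (fun a => acut u (a - h)).
Proof.
move=> FBu h0 a /andP[ha a1].
have ah : 0 < a - h <= 1 by rewrite subr_gt0 ha/=; move: h0 a1; lra.
split; first by apply: acut_nebounded => //; move: ah; lra.
move=> e /(acut_left_hd FBu ah)[d /andP[d0 _] dP]; exists d => // b ab hb.
by apply: dP; move: ab; lra.
Qed.

Lemma hd_left_continuous_acut u h : FB R m u -> 0 <= h -> hd_left_continuous h (acut u).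
Proof.
move=> FBu h0; apply: (hd_left_continuous_le h0).
have := hd_left_continuous_acutB FBu (lexx 0).
by under eq_fun do rewrite subr0.
Qed.

Definition dcut u v := cutdist 0 (acut u) (acut v).
Definition tcut h u := cutdist h (acut u) (fun a => acut u (a - h)).

Lemma mfun_dcut u v : FB R m u -> FB R m v -> mfunR (dcut u v).
Proof. by move=> FBu FBv; apply: cutdist_mfun; exact: hd_left_continuous_acut. Qed.

Lemma mfun_tcut h u : FB R m u -> 0 <= h -> mfunR (tcut h u).
Proof.
by move=> FBu h0; apply: cutdist_mfun;
  [exact: hd_left_continuous_acut|exact: hd_left_continuous_acutB].
Qed.

Lemma hd_acut_bounded u v : FB R m u -> FB R m v -> exists2 c, 0 <= c &
  forall a b, 0 <= a <= 1 -> 0 <= b <= 1 -> hd (acut u a) (acut v b) <= c.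
Proof.
move=> FBu FBv; have [_ _ _ [M uM]] := FBu; have [_ _ _ [N vN]] := FBv.
have [x ux] : acut u 0 !=set0 by have [] := @acut_nebounded _ _ u 0 FBu; rewrite ?lexx ?ler01.
have [y vy] : acut v 0 !=set0 by have [] := @acut_nebounded _ _ v 0 FBv; rewrite ?lexx ?ler01.
have M0 : 0 <= M := le_trans (enorm_ge0 _) (uM _ ux).
have N0 : 0 <= N := le_trans (enorm_ge0 _) (vN _ vy).
have near_MN s t z z' : enorm (z : 'rV[R]_m) <= s -> enorm z' <= t ->
    edistance z z' <= s + t.
  move=> zs zt; rewrite /edistance (le_trans (enormD _ _))// enormN lerD//.
have sub w a : FB R m w -> 0 <= a <= 1 -> acut w a `<=` acut w 0.
  by move=> _ /andP[a0 _]; apply: acut_subset; rewrite lexx.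
exists (M + N); first by rewrite addr_ge0.
move=> a b a01 b01; have [[x' ux'] _] := acut_nebounded FBu a01.
have [[y' vy'] _] := acut_nebounded FBv b01.
apply: hd_le => [||f ef z uz|f ef z vz]; [exact: acut_nebounded|exact: acut_nebounded| |].
- exists y' => //; apply: le_lt_trans ef; apply: near_MN; first exact/uM/(sub u a).
  exact/vN/(sub v b).
- exists x' => //; apply: le_lt_trans ef; rewrite addrC; apply: near_MN.
    exact/vN/(sub v b).
  exact/uM/(sub u a).
Qed.

Lemma cutdist_bound c A B (C : R) : 0 <= c -> 0 <= C ->
  (forall a, c < a <= 1 -> hd (A a) (B a) <= C) ->
  forall a, 0 <= cutdist c A B a <= C * \1_`]0, 1]%classic a.
Proof.
move=> c0 C0 AB a; rewrite cutdist_ge0/= /cutdist indicE mem_setE in_itv/=.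
case: ifPn => [ca|_]; last by rewrite mulr_ge0.
by have /andP[ca1 ->] := ca; rewrite (le_lt_trans c0 ca1) mulr1 AB.
Qed.

Lemma FB_max u v : FB R m u -> FB R m v -> FB R m (u \max v).
Proof.
move=> [fu [x ux] uscu [M uM]] [fv [y vy] uscv [N vN]]; split.
- move=> z; have /andP[u0 u1] := fu z; have /andP[v0 v1] := fv z.
  by rewrite /= le_max u0 ge_max u1 v1.
- exists x => /=; apply/eqP; rewrite ux eq_le ge_max lexx/= le_max lexx andbT.
  by have /andP[] := fv x.
- move=> z a /=; rewrite gt_max => /andP[uz vz].
  have /nbhs_edistance[e e0 eP] := uscu _ _ uz.
  have /nbhs_edistance[f f0 fP] := uscv _ _ vz.
  apply/nbhs_edistance; exists (Num.min e f); first by rewrite lt_min e0.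
  by move=> t; rewrite lt_min => /andP[zt1 zt2]; rewrite gt_max eP ?fP.
- exists (Num.max M N) => z; rewrite /acut eqxx.
  rewrite (_ : [set x0 | _] = [set t | 0 < u t] `|` [set t | 0 < v t]); last first.
    apply/seteqP; split=> t /=; rewrite lt_max; first by move/orP.
    by move=> /orP.
  rewrite closureU le_max => -[uz|vz].
    by rewrite uM// /acut eqxx.
  by rewrite vN ?orbT// /acut eqxx.
Qed.

Lemma closed_eball (r : R) : closed (@eball R m r).
Proof.
move=> x clx; rewrite /eball/=; apply/ler_addgt0Pr => e e0.
have [|y [yr]] := clx [set y | edistance x y < e].
  by apply/nbhs_edistance; exists e.
move=> /= xy; rewrite (le_trans (enorm_le_edistance x y))// lerD//; exact: ltW.
Qed.

Lemma ball_hatE (r a : R) x : 0 < a <= 1 -> (a <= ball_hat r x) = (enorm (x : 'rV[R]_m) <= r).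
Proof.
move=> /andP[a0 a1]; rewrite /ball_hat indicE; have [xr|xr] := boolP (enorm x <= r).
  by rewrite mem_set.
by rewrite memNset/= ?leNgt ?a0//; apply/negP.
Qed.

Lemma FB_ball_hat (r : R) : 0 <= r -> FB R m (ball_hat r).
Proof.
move=> r0; split.
- by move=> x; rewrite /ball_hat indicE ler0n lern1; case: (_ \in _).
- exists 0; rewrite /ball_hat indicE mem_set//= /eball/= enorm0//.
- move=> x a; have [xr|xr] := pselect (eball r x).
    rewrite {1}/ball_hat indicE mem_set// => a1.
    apply/nbhs_edistance; exists 1 => // y _.
    by apply: le_lt_trans a1; rewrite /ball_hat indicE lern1; case: (_ \in _).
  rewrite {1}/ball_hat indicE memNset// => a0.
  have oC : open (~` (@eball R m r)) by apply: closed_openC; exact: closed_eball.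
  have /nbhs_edistance[e e0 eP] := open_nbhs_nbhs (conj oC xr).
  apply/nbhs_edistance; exists e => // y /eP yr.
  by rewrite /ball_hat indicE memNset.
- exists r => x; rewrite /acut eqxx => clx; apply: closed_eball.
  apply: closure_subset clx => y /=; rewrite /ball_hat indicE.
  by case: (boolP (y \in _)) => [/set_mem//|_]; rewrite ltxx.
Qed.

Lemma zero_hat_ball : @zero_hat R m = ball_hat 0.
Proof.
rewrite /zero_hat /ball_hat; congr indic; apply/seteqP; split=> x /=.
  by move=> ->; rewrite /eball/= enorm0.
rewrite /eball/= => x0; apply: edistance_eq0; apply/eqP.
by rewrite eq_le edistance_ge0 /edistance subr0 x0.
Qed.

Lemma acut_max u v a : 0 < a -> acut (u \max v) a = acut u a `|` acut v a.
Proof.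
move=> a0; rewrite !acutE//; apply/seteqP; split=> x /=; rewrite le_max.
  by move/orP.
by move=> /orP.
Qed.

End CutDistance.

(** * The metric axioms for [dp] *)

Section DpMetric.
Context {R : realType} {m : nat}.
Variable p : R.
Hypothesis p1 : 1 <= p.
Implicit Types (u v w : 'rV[R]_m -> R) (a b c h : R).

Lemma dpE u v : FB R m u -> FB R m v -> dp p u v = LpN p (dcut u v).
Proof.
move=> FBu FBv; apply: integral_LpN => //.
- exact: mfun_dcut.
- by move=> a; exact: cutdist_ge0.
- by move=> a /negP/negbTE na; rewrite /dcut /cutdist na.
- move=> a a01; rewrite /dcut /cutdist a01 hdE//; apply: acut_nebounded => //;
  by case/andP: a01 => /ltW -> ->.
Qed.

Lemma equiE u h : FB R m u -> 0 <= h ->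
  ((\int[lebesgue_measure]_(a in `[h, 1%R])
     (hausdorff_dist (acut u a) (acut u (a - h)%R) `^ p)) `^ p^-1)%E =
  LpN p (tcut h u).
Proof.
move=> FBu h0; apply: integral_LpN => //.
- exact: mfun_tcut.
- by move=> a; exact: cutdist_ge0.
- by move=> a /negP/negbTE na; rewrite /tcut /cutdist na.
- move=> a ah; rewrite /tcut /cutdist ah hdE//; apply: acut_nebounded => //;
  by case/andP: ah; lra.
Qed.

Lemma dp_ge0 u v : (0 <= dp p u v)%E.
Proof. exact: poweR_ge0. Qed.

Lemma dpC u v : FB R m u -> FB R m v -> dp p u v = dp p v u.
Proof. by move=> FBu FBv; rewrite !dpE// /dcut cutdistC. Qed.

Lemma dp_triangle v u w : FB R m u -> FB R m v -> FB R m w ->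
  (dp p u w <= dp p u v + dp p v w)%E.
Proof.
move=> FBu FBv FBw; rewrite !dpE//.
apply: le_trans (LpND p1 (mfun_dcut FBu FBv) (mfun_dcut FBv FBw)).
apply: LpN_le => //; first exact: mfun_dcut.
  by apply: measurable_funD; exact: mfun_dcut.
by move=> a; rewrite cutdist_ge0 cutdist_triangle//; exact: hd_left_continuous_acut.
Qed.

Lemma dp_lty u v : FB R m u -> FB R m v -> (dp p u v < +oo)%E.
Proof.
move=> FBu FBv; rewrite dpE//; have [c c0 uvc] := hd_acut_bounded FBu FBv.
apply: (@le_lt_trans _ _ c%:E); last exact: ltry.
apply: LpN_bounded => //; first exact: mfun_dcut.
apply: cutdist_bound => // a /andP[a0 a1]; apply: uvc; by rewrite ltW.
Qed.

Lemma dpxx u : FB R m u -> dp p u u = 0%E.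
Proof.
move=> FBu; apply/eqP; rewrite eq_le dp_ge0 andbT dpE//.
apply: LpN_bounded => //; first exact: mfun_dcut.
apply: cutdist_bound => // a /andP[a0 a1]; rewrite hdxx//.
by apply: acut_nebounded => //; rewrite ltW.
Qed.

(** If [f x > 0], then [f >= f x / 2] on some []x - d, x]], an interval of positive length, which
    makes the norm positive. *)
Lemma left_continuous_LpN0 (f : R -> R) : left_continuous f ->
  (forall x, 0 <= f x) -> LpN p f = 0%E -> forall x, f x = 0.
Proof.
move=> lcf f0 N0 x; apply/eqP; apply: contrapT => /negP fx.
have fx0 : 0 < f x by rewrite lt_neqAle f0 eq_sym fx.
have [d d0 dP] := lcf x (f x / 2) (divr_gt0 fx0 (ltr0Sn _ _)).
have : (LpN p (fun y => f x / 2 * \1_`]x - d, x]%classic y)%R <= LpN p f)%E.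
  apply: LpN_le => //.
  - by apply: measurable_funM; [exact: measurable_cst|exact: measurable_indic].
  - exact: left_continuous_measurable.
  - move=> y; rewrite indicE mem_setE in_itv/=.
    case: (boolP (x - d < y <= x)) => [yd|_].
      have := dP y yd; rewrite mulr1 divr_ge0 ?(ltW fx0)//= ler_norml => /andP[_]; lra.
    by rewrite mulr0 lexx f0.
rewrite N0 LpN_itv//; last 2 first.
- by rewrite lerBlDr lerDl ltW.
- by rewrite divr_ge0 ?ltW.
rewrite lee_fin leNgt mulr_gt0 ?divr_gt0// powR_gt0//.
by rewrite opprB addrCA subrr addr0.
Qed.

(** Distance 0 forces the cuts at every level of []0, 1]] to be at Hausdorff distance 0. At level
    [u x] this gives points arbitrarily close to [x] where [v >= u x], and upper semicontinuity of
    [v] concludes. *)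
Lemma dp_eq0_le u v : FB R m u -> FB R m v -> dp p u v = 0%E ->
  forall x, u x <= v x.
Proof.
move=> FBu FBv; rewrite dpE// => N0 x.
have [fu _ _ _] := FBu; have [fv _ uscv _] := FBv.
have /andP[] := fu x; rewrite le_eqVlt => /predU1P[<- _|ux0 ux1].
  by have /andP[] := fv x.
have lc : left_continuous (dcut u v).
  by apply: cutdist_left_continuous; exact: hd_left_continuous_acut.
have := left_continuous_LpN0 lc (fun a => cutdist_ge0 _ _ _ a) N0 (u x).
rewrite /dcut /cutdist ux0 ux1/= => h0.
have u01 : 0 <= u x <= 1 by rewrite ltW.
rewrite leNgt; apply/negP => /uscv/nbhs_edistance[e e0 eP].
have [|y vy xy] := @hd0_nearby _ _ _ _ e (acut_nebounded FBu u01) (acut_nebounded FBv u01) h0 e0 x.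
  by rewrite acutE/=.
by move: vy; rewrite acutE//= leNgt eP.
Qed.

Lemma dp_eq0 u v : FB R m u -> FB R m v -> dp p u v = 0%E -> u = v.
Proof.
move=> FBu FBv uv0; have vu0 := uv0; rewrite (dpC FBu FBv) in vu0.
by apply/funext => x; apply/le_anti; rewrite (dp_eq0_le FBu FBv uv0) (dp_eq0_le FBv FBu vu0).
Qed.

End DpMetric.

(** * Greedy extraction of subsequences *)

Section Subsequence.

Lemma subsequence_exists (P : nat -> nat -> Prop) :
  (forall k N, exists2 n, (N <= n)%N & P k n) ->
  exists phi : nat -> nat, {homo phi : i j / (i < j)%N} /\ forall k, P k (phi k).
Proof.
move=> PN; have /choice[g gP] : forall kN : nat * nat, exists n,
    (kN.2 <= n)%N /\ P kN.1 n.
  by move=> [k N]; have [n Nn Pn] := PN k N; exists n.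
(* Each search starts just after the previous index, which makes [phi] strictly increasing. *)
pose fix phi k := if k is k'.+1 then g (k, (phi k').+1) else g (0, 0)%N.
exists phi; split; last first.
  by case=> [|k] /=; [have [] := gP (0, 0)%N|have [] := gP (k.+1, (phi k).+1)].
apply: homo_ltn; first exact: ltn_trans.
by move=> k /=; have [] := gP (k.+1, (phi k).+1).
Qed.

End Subsequence.

(** * The mean modulus of left continuity and the excess over a ball *)

Section MeanLeftContinuity.
Context {R : realType} {m : nat}.
Variable p : R.
Hypothesis p1 : 1 <= p.
Implicit Types (u v w : 'rV[R]_m -> R) (a b c h : R).

(** A failure yields shifts [h n] tending to 0. Left continuity of the cuts makes [tcut (h n) u]
    tend to 0 pointwise, and boundedness of the support dominates it. *)
Lemma tcut_cvg0 u e : FB R m u -> 0 < e -> exists2 d, 0 < d &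
  forall h, 0 <= h < d -> (LpN p (tcut h u) <= e%:E)%E.
Proof.
move=> FBu e0; apply: contrapT => /forall2NP nP.
have /choice[h hP] : forall n, exists h : R,
    0 <= h < n.+1%:R^-1 /\ ~ (LpN p (tcut h u) <= e%:E)%E.
  move=> n; have [|/existsNP[h /not_implyP[hn hN]]] := nP n.+1%:R^-1.
    by rewrite invr_gt0 ltr0Sn.
  by exists h.
have h0 n : 0 <= h n by have [/andP[]] := hP n.
have [c c0 uc] := hd_acut_bounded FBu FBu.
have [] := @LpN_cvg0 _ _ p1 (fun n => tcut (h n) u) c _ c0 _ _ e e0.
- by move=> n; exact: mfun_tcut.
- by move=> n x; apply: cutdist_bound => // a /andP[ha a1]; apply: uc;
    move: (h0 n) ha a1; lra.
- move=> a; have [a01|a01] := boolP (0 < a <= 1); last first.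
    rewrite (_ : (fun n => _) = cst 0); first exact: cvg_cst.
    apply/funext => n; rewrite /tcut /cutdist; case: ifPn => // /andP[ha a1].
    by move: a01; rewrite a1 (le_lt_trans (h0 n) ha).
  apply/cvgrPdist_le => f f0; have [d /andP[d0 da] dP] := acut_left_hd FBu a01 f0.
  near=> n; rewrite sub0r normrN ger0_norm ?cutdist_ge0// /tcut /cutdist.
  case: ifPn => [/andP[ha _]|_]; last exact: ltW.
  rewrite hdC; apply: dP; rewrite gerBl h0 andbT ltrD2l ltrN2.
  have [/andP[_ hn] _] := hP n; apply: lt_trans hn _.
  by near: n; exact: (near_infty_natSinv_lt (PosNum d0)).
- by move=> N _ /(_ N (leqnn N)); have [_] := hP N.
Unshelve. all: by end_near. Qed.

(** The triangle inequality passes through the cuts of [v] at levels [a] and [a - h]. The last term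
    is [dcut u v] translated by [h], whose norm is again [dp p u v]. *)
Lemma tcut_triangle u v h : FB R m u -> FB R m v -> 0 <= h ->
  (LpN p (tcut h u) <= dp p u v + LpN p (tcut h v) + dp p u v)%E.
Proof.
move=> FBu FBv h0; rewrite !dpE//.
have m1 := mfun_dcut FBu FBv; have m2 := mfun_tcut FBv h0.
have m3 := mfun_tcut FBu h0.
rewrite -[X in (_ <= _ + X)%E](LpN_shift p (- h) m1).
have m12 : mfunR (fun a => dcut u v a + tcut h v a)%R by exact: measurable_funD.
have m4 : mfunR (fun a => dcut u v (a - h)) by exact: mfunR_shift.
apply: le_trans; last by apply: leeD2r; exact: LpND.
apply: le_trans; last by apply: LpND.
apply: LpN_le => //; first exact: measurable_funD.
move=> a; rewrite cutdist_ge0/= /tcut {1}/cutdist; case: ifPn => [ha|_]; last first.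
  by rewrite !addr_ge0 ?cutdist_ge0.
have b1 w : FB R m w -> nebounded (acut w a).
  by move=> FBw; apply: acut_nebounded => //; move: ha h0; lra.
have b2 w : FB R m w -> nebounded (acut w (a - h)).
  by move=> FBw; apply: acut_nebounded => //; move: ha h0; lra.
rewrite /dcut /cutdist ha ifT; last by move: ha h0; lra.
rewrite ifT; last by move: ha h0; lra.
rewrite (le_trans (hd_triangle (b1 _ FBu) (b2 _ FBv) (b2 _ FBu)))//.
rewrite (hdC (acut u (a - h))) lerD2r.
exact: hd_triangle (b1 _ FBu) (b1 _ FBv) (b2 _ FBv).
Qed.

(** The cuts of [v] lie in the ball, so a point of a cut of [u] is at least as close to the ball as
    to the cut of [v]; points of the ball itself cost nothing. *)
Lemma excess_le_dp u v (r : R) : FB R m u -> FB R m v -> 0 <= r ->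
  (forall x, acut v 0 x -> enorm x <= r) -> (excess p r u <= dp p u v)%E.
Proof.
move=> FBu FBv r0 vr; have FBr := @FB_ball_hat R m r r0; have FBur := FB_max FBu FBr.
rewrite -[excess p r u]/(dp p (u \max ball_hat r) (ball_hat r)) !dpE//.
apply: LpN_le => //; [exact: mfun_dcut|exact: mfun_dcut|].
move=> a; rewrite cutdist_ge0/= /dcut /cutdist; case: ifPn => // a01.
have a01' : 0 <= a <= 1 by move: a01; lra.
have a0 : 0 < a by move: a01; lra.
apply: hd_le; [exact: acut_nebounded|exact: acut_nebounded|move=> f ef..].
- have [uv _] := hd_lt (acut_nebounded FBu a01') (acut_nebounded FBv a01') ef.
  move=> x; rewrite acut_max// => -[/uv[y vy xy]|xr].
    exists y => //; rewrite acutE//= ball_hatE//; apply: vr.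
    by apply: acut_subset vy; rewrite lexx ltW.
  by exists x => //; rewrite edistancexx; apply: le_lt_trans ef; exact: hd_ge0.
- apply: sub_nearby; first by apply: le_lt_trans ef; exact: hd_ge0.
  by rewrite acut_max//; exact: subsetUr.
Qed.

End MeanLeftContinuity.

(** * The topology of [dp]: neighbourhoods, separation, cluster points *)

Section DpTopology.
Context {R : realType} {m : nat}.
Variables (p : R) (X : set ('rV[R]_m -> R)).
Hypothesis p1 : 1 <= p.
Hypothesis XFB : X `<=` FB R m.
Local Notation T := (dp_space p X).
Implicit Types (u v w : T).

Lemma dp_space_FB u : FB R m u. Proof. by apply: XFB; exact: dp_valP. Qed.
Local Hint Resolve dp_space_FB : core.

Lemma dp_ball_open u (e : R) : open (dp_ball u e).
Proof.
move=> v; rewrite /dp_ball/= => uv.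
have fuv : dp p u v \is a fin_num by rewrite ge0_fin_numE ?dp_ge0// dp_lty.
exists (e - fine (dp p u v)).
  by rewrite subr_gt0 -lte_fin fineK.
move=> w vw; rewrite /dp_ball/=.
apply: le_lt_trans (dp_triangle p1 (dp_space_FB u) (dp_space_FB v) (dp_space_FB w)) _.
by rewrite -(subrKC (fine (dp p u v)) e) EFinD (fineK fuv) (lteD2lE _ _ fuv).
Qed.

Lemma nbhs_dp u (V : set T) :
  nbhs u V <-> exists2 e : R, 0 < e & dp_ball u e `<=` V.
Proof.
rewrite nbhsE; split=> [[B [oB Bu] BV]|[e e0 eV]].
  by have [e e0 eB] := oB u Bu; exists e => //; exact: subset_trans BV.
exists (dp_ball u e) => //; split; first exact: dp_ball_open.
by rewrite /dp_ball/= dpxx.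
Qed.

(** Inseparable points are at distance at most [e] for all [e], hence are the same function; proof
    irrelevance then identifies the two records. *)
Lemma dp_space_hausdorff : hausdorff_space T.
Proof.
move=> u v uv.
suff /dp_eq0 uv0 : dp p u v = 0%E.
  case: u v uv uv0 => [u Xu] [v Xv] _ /= uv0.
  have {}uv0 : u = v by apply: uv0 => //; exact: XFB.
  by subst v; congr DpSpace; exact: Prop_irrelevance.
apply/eqP; rewrite eq_le dp_ge0 andbT; apply/lee_addgt0Pr => e e0; rewrite add0e.
have e2 : 0 < e / 2 by rewrite divr_gt0.
have nu : nbhs u (dp_ball u (e / 2)) by apply/nbhs_dp; exists (e / 2).
have nv : nbhs v (dp_ball v (e / 2)) by apply/nbhs_dp; exists (e / 2).
have [w [uw vw]] := uv _ _ nu nv.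
have {}uw : (dp p u w < (e / 2)%:E)%E := uw.
have {vw}wv : (dp p v w < (e / 2)%:E)%E := vw.
rewrite (dpC p1 (dp_space_FB v) (dp_space_FB w)) in wv.
apply: le_trans (dp_triangle p1 (dp_space_FB u) (dp_space_FB w) (dp_space_FB v)) _.
rewrite (splitr e) EFinD.
exact: leeD (ltW uw) (ltW wv).
Qed.

Lemma compact_seq_cluster (K : set T) (u : nat -> T) : compact K ->
  (forall n, K (u n)) -> exists2 v, K v &
  forall (e : R) N, 0 < e -> exists2 n, (N <= n)%N & (dp p v (u n) < e%:E)%E.
Proof.
move=> cK Ku; have [|v [Kv clv]] := cK (u @ \oo) _; first by exists 0%N => // n _; exact: Ku.
exists v => // e N e0.
have uN : (u @ \oo) [set u n | n in [set n | (N <= n)%N]].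
  by exists N => // n /= Nn; exists n.
have nv : nbhs v (dp_ball v e) by apply/nbhs_dp; exists e.
have [_ [[n Nn <-] vn]] := clv _ _ uN nv.
by exists n.
Qed.

End DpTopology.

(** * Compactness implies the conditions *)

Section Necessity.
Context {R : realType} {m : nat}.
Variables (p : R) (X U : set ('rV[R]_m -> R)).
Hypothesis p1 : 1 <= p.
Hypothesis XFB : X `<=` FB R m.
Hypothesis UX : U `<=` X.
Hypothesis cU : compact [set u : dp_space p X | U u].

Let seq_cluster (u : nat -> 'rV[R]_m -> R) : (forall n, U (u n)) ->
  exists2 v, FB R m v &
  forall (e : R) N, 0 < e -> exists2 n, (N <= n)%N & (dp p (u n) v < e%:E)%E.
Proof.
move=> Uu; pose w n : dp_space p X := DpSpace p (UX (Uu n)).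
have [|v Uv clv] := @compact_seq_cluster _ _ _ _ p1 XFB _ w cU; first exact: Uu.
have FBv := dp_space_FB XFB v.
exists v; first exact: FBv.
move=> e N /(clv _ N)[n Nn un]; exists n; first exact: Nn.
by rewrite (dpC p1 (XFB (UX (Uu n))) FBv).
Qed.

Lemma compact_p_mean_bounded : p_mean_bounded p U.
Proof.
apply: contrapT => /forall2NP nb.
have /choice[u uP] : forall n : nat, exists u,
    U u /\ ~ (dp p u zero_hat <= n.+1%:R%:E)%E.
  move=> n; have [|/existsNP[u /not_implyP[Uu ?]]] := nb n.+1%:R.
    by rewrite ltr0Sn.
  by exists u.
have [|v FBv vP] := seq_cluster (u := u); first by move=> n; have [] := uP n.
have FB0 : FB R m zero_hat by rewrite zero_hat_ball; exact: FB_ball_hat.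
have fv0 : dp p v zero_hat \is a fin_num by rewrite ge0_fin_numE ?dp_ge0// dp_lty.
(* From this index on, [n + 1] exceeds [1 + dp p v zero_hat], which bounds the distance from [u n]
   to [zero_hat] when [u n] is within 1 of [v]. *)
pose N := Num.trunc (1 + fine (dp p v zero_hat)).
have [n Nn un] := vP 1 N ltr01.
have [Uu] := uP n; apply.
have FBu : FB R m (u n) by exact/XFB/UX.
apply: le_trans (dp_triangle p1 FBu FBv FB0) _.
apply: (@le_trans _ _ (1%:E + (fine (dp p v zero_hat))%:E)%E).
  by rewrite fineK// leeD2r// ltW.
rewrite -EFinD lee_fin ltW// (lt_le_trans (truncnS_gt _))//.
by rewrite ler_nat ltnS.
Qed.

Lemma compact_equi_left_continuous : p_mean_equi_left_continuous p U.
Proof.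
move=> e e0; apply: contrapT => /forall2NP nb.
have /choice[z zP] : forall n : nat, exists z : R * ('rV[R]_m -> R),
    [/\ 0 <= z.1 < n.+1%:R^-1, U z.2 & (e%:E <= LpN p (tcut z.1 z.2))%E].
  move=> n; have [|/existsNP[h /not_implyP[hn /existsNP[u /not_implyP[Uu]]]]] := nb n.+1%:R^-1.
    by rewrite invr_gt0 ltr0Sn.
  rewrite equiE//; [|exact/XFB/UX|by case/andP: hn] => /negP; rewrite -leNgt => le.
  by exists (h, u).
have [|v FBv vP] := seq_cluster (u := fun n => (z n).2).
  by move=> n; have [] := zP n.
(* [tcut_triangle] has three terms; each is made at most [e / 4], so the sum stays strictly below
   [e]. *)
have e4 : 0 < e / 4 by rewrite divr_gt0.
have [d d0 dP] := tcut_cvg0 p1 FBv e4.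
have [N _ NP] := near_infty_natSinv_lt (PosNum d0).
have [n Nn un] := vP _ N e4.
have [/andP[h0 hn] Uz] := zP n; apply/negP; rewrite -ltNge.
have FBz : FB R m (z n).2 by exact/XFB/UX.
apply: le_lt_trans (tcut_triangle p1 FBz FBv h0) _.
apply: (@le_lt_trans _ _ ((e / 4)%:E + (e / 4)%:E + (e / 4)%:E)%E).
  apply: leeD; last exact: ltW.
  apply: leeD; first exact: ltW.
  apply: dP; rewrite h0/=.
  exact: lt_trans hn (NP n Nn).
by rewrite -!EFinD lte_fin; lra.
Qed.

Lemma compact_excess_cvg0 (u : nat -> 'rV[R]_m -> R) : (forall n, U (u n)) ->
  exists r : R, 0 < r /\ exists phi : nat -> nat,
    {homo phi : i j / (i < j)%N} /\
    excess p r (u (phi n)) @[n --> \oo] --> 0%:E.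
Proof.
move=> Uu; have [v FBv vP] := seq_cluster Uu.
have [_ _ _ [M vM]] := FBv.
(* A positive radius whose ball contains the support of the cluster point [v]. *)
exists (`|M| + 1); split; first by rewrite ltr_wpDl.
have [|phi [iphi phiP]] := @subsequence_exists
    (fun k n => (dp p (u n) v < k.+1%:R^-1%:E)%E).
  by move=> k N; apply: vP; rewrite invr_gt0 ltr0Sn.
exists phi; split=> //.
apply: (@squeeze_cvge _ _ _ _ (cst 0%E) _ (fun n => (n.+1%:R^-1)%:E)).
- apply: nearW => n; rewrite poweR_ge0/=.
  apply: le_trans (ltW (phiP n)); apply: excess_le_dp => //.
  + exact/XFB/UX.
  + by move=> x /vM xM; rewrite (le_trans xM)// (le_trans (ler_norm _))// lerDl.
- exact: cvg_cst.
- by apply: cvg_EFin; [exact: nearW|exact: cvg_harmonic].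
Qed.

Lemma compact_closed_dp : closed [set u : dp_space p X | U u].
Proof. by apply: compact_closed => //; exact: dp_space_hausdorff. Qed.

End Necessity.

(** * Sequential cluster points imply compactness in the metric [dp] *)

Section SequentialCompactness.
Context {R : realType} {m : nat}.
Variables (p : R) (X : set ('rV[R]_m -> R)).
Hypothesis p1 : 1 <= p.
Hypothesis XFB : X `<=` FB R m.
Local Notation T := (dp_space p X).

Definition seq_cluster_in (K : set T) := forall u : nat -> T, (forall n, K (u n)) ->
  exists2 v, K v &
  forall (e : R) N, 0 < e -> exists2 n, (N <= n)%N & (dp p v (u n) < e%:E)%E.

Lemma dp_half (u v w : T) (e : R) : (dp p u v < (e / 2)%:E)%E ->
  (dp p v w < (e / 2)%:E)%E -> (dp p u w < e%:E)%E.
Proof.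
move=> uv vw; apply: le_lt_trans (dp_triangle p1 (dp_space_FB XFB u)
  (dp_space_FB XFB v) (dp_space_FB XFB w)) _.
by rewrite (splitr e) EFinD; exact: lteD uv vw.
Qed.

(** Without a finite [e]-net, points at mutual distance at least [e] can be chosen forever, but a
    cluster point has two of them within [e / 2]. *)
Lemma seq_cluster_totally_bounded (K : set T) (e : R) : seq_cluster_in K -> 0 < e ->
  exists2 s : seq T, (forall w, w \in s -> K w) &
    forall x, K x -> exists2 w, w \in s & (dp p w x < e%:E)%E.
Proof.
move=> Kc e0; apply: contrapT => /forall2NP nb.
have far (s : seq T) : (forall w, w \in s -> K w) ->
    exists2 x, K x & forall w, w \in s -> (e%:E <= dp p w x)%E.
  move=> sK; have [//|/existsNP[x /not_implyP[Kx /forall2NP xs]]] := nb s.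
  exists x => // w ws; rewrite leNgt; apply/negP => wx.
  by have [] := xs w.
have [x0 Kx0 _] := far [::] (fun w => ltac:(by [])).
have /choice[g gP] : forall s : seq T, exists x, (forall w, w \in s -> K w) ->
    K x /\ forall w, w \in s -> (e%:E <= dp p w x)%E.
  move=> s; have [/far[x Kx xP]|nK] := pselect (forall w, w \in s -> K w).
    by exists x.
  by exists x0.
(* [f n] lists the first [n] chosen points, and [g (f n)] is the next one. *)
pose f := fix f n := if n is k.+1 then g (f k) :: f k else [::].
have fK n : forall w, w \in f n -> K w.
  elim: n => [//|n ih] w; rewrite /= inE => /predU1P[->|/ih//].
  by have [] := gP _ ih.
have fin i j : (i < j)%N -> g (f i) \in f j.
  elim: j => // j ih; rewrite ltnS leq_eqVlt => /predU1P[->|/ih ij].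
    by rewrite inE eqxx.
  by rewrite inE ij orbT.
have [|v Kv vP] := Kc (fun n => g (f n)).
  by move=> n; have [] := gP _ (fK n).
have e2 : 0 < e / 2 by rewrite divr_gt0.
have [i _ vi] := vP _ 0%N e2; have [j ij vj] := vP _ i.+1 e2.
have iv : (dp p (g (f i)) v < (e / 2)%:E)%E.
  by rewrite (dpC p1 (dp_space_FB XFB (g (f i))) (dp_space_FB XFB v)); exact: vi.
have [_ /(_ _ (fin _ _ ij))] := gP _ (fK j).
by move=> /(lt_le_trans (dp_half iv vj)); rewrite ltxx.
Qed.

Lemma ultra_finite_union {A : Type} (F : set_system A) {UF : UltraFilter F} (I : eqType)
    (s : seq I) (f : I -> set A) :
  F [set x | exists2 w, w \in s & f w x] -> exists2 w, w \in s & F (f w).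
Proof.
elim: s => [|w s ih] Fs.
  by have [x []] := @filter_ex _ F _ _ Fs.
have [Fw|nFw] := in_ultra_setVsetC (f w) UF; first by exists w; rewrite ?mem_head.
have [|w' ws Fw'] := ih; last by exists w' => //; rewrite inE ws orbT.
apply: filterS2 Fs nFw => x [w']; rewrite inE => /predU1P[->//|ws fx _].
by exists w'.
Qed.

(** By total boundedness an ultrafilter on [K] contains, for each [k], a ball of radius
    [1 / (k + 1)]. It converges to any cluster point of the centres of these balls. *)
Lemma seq_cluster_compact (K : set T) : seq_cluster_in K -> compact K.
Proof.
move=> Kc; rewrite compact_ultra => F UF FK.
have /choice[w wP] : forall k, exists w, K w /\ F (dp_ball w k.+1%:R^-1).
  move=> k; have k0 : 0 < k.+1%:R^-1 :> R by rewrite invr_gt0 ltr0Sn.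
  have [s sK sP] := seq_cluster_totally_bounded Kc k0.
  have [|w ws Fw] := @ultra_finite_union _ F UF _ s
      (fun w => dp_ball w k.+1%:R^-1).
    by apply: filterS FK => x /sP.
  by exists w; split=> //; exact: sK.
have [|v Kv vP] := Kc w; first by move=> k; have [] := wP k.
exists v; split=> // V /(nbhs_dp p1 XFB)[e e0 eV].
have e2 : 0 < e / 2 by rewrite divr_gt0.
have [N _ NP] := near_infty_natSinv_lt (PosNum e2).
have [k Nk vk] := vP _ N e2; have [_] := wP k.
apply: filterS => x wx; apply: eV; apply: (dp_half vk).
by apply: lt_trans wx _; rewrite lte_fin; exact: NP.
Qed.

End SequentialCompactness.

(** * The limit of the cuts along an ultrafilter and its fuzzy set *)

Section Limit.
Context {R : realType} {m : nat}.
Variable p : R.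
Hypothesis p1 : 1 <= p.
Variables (r : R) (G : set_system nat) (v : nat -> 'rV[R]_m -> R).
Context {UG : UltraFilter G}.
Hypothesis r0 : 0 <= r.
Hypothesis FBv : forall n, FB R m (v n).
Hypothesis excess_v : forall e : R, 0 < e -> G [set n | (excess p r (v n) < e%:E)%E].

Let FBr : FB R m (ball_hat r) := FB_ball_hat r0.
Let FBvr n : FB R m (v n \max ball_hat r) := FB_max (FBv n) FBr.

(** A point of [acut w a] outside the ball of radius [r + e] lies in all cuts at levels [b <= a].
    The distance to the ball is then at least [e] on []0, a]], and the excess at least
    [e * a^(1/p)]. *)
Lemma excess_cut w (a e : R) : FB R m w -> 0 < a <= 1 -> 0 < e ->
  (excess p r w < (e * a `^ p^-1)%:E)%E -> forall x, acut w a x -> enorm x <= r + e.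
Proof.
move=> FBw /andP[a0 a1] e0 wa x wx; rewrite leNgt; apply/negP => xre.
have FBwr := FB_max FBw FBr.
move: wa; apply/negP; rewrite -leNgt.
rewrite -[excess p r w]/(dp p (w \max ball_hat r) (ball_hat r)) dpE//.
rewrite -[in X in (X <= _)%E](subr0 a) -LpN_itv ?(ltW a0) ?(ltW e0)//.
apply: LpN_le => //; [|exact: mfun_dcut|].
  by apply: measurable_funM; [exact: measurable_cst|exact: measurable_indic].
move=> b; rewrite indicE mem_setE in_itv/=; apply/andP; split; first by rewrite mulr_ge0 ?(ltW e0).
have [/andP[b0 ba]|_] := boolP (0 < b <= a); last by rewrite /= mulr0 cutdist_ge0.
have b1 : b <= 1 by exact: le_trans a1.
rewrite mulr1 /dcut /cutdist b0 b1/= leNgt; apply/negP => hde.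
have b01 : 0 <= b <= 1 by rewrite ltW.
have [near_ _] := hd_lt (acut_nebounded FBwr b01) (acut_nebounded FBr b01) hde.
have [|y yr xy] := near_ x.
  by rewrite acut_max//; left; apply: acut_subset wx; rewrite ltW.
move: yr; rewrite acutE//= ball_hatE ?b0// => yr.
by move: xre (enorm_le_edistance x y) xy yr; lra.
Qed.

Lemma near_cut_ball (a e : R) : 0 < a <= 1 -> 0 < e ->
  G [set n | forall x, acut (v n) a x -> enorm x <= r + e].
Proof.
move=> a01 e0; have a0 : 0 < a by case/andP: a01.
have ea : 0 < e * a `^ p^-1 by rewrite mulr_gt0// powR_gt0.
by apply: filterS (excess_v ea) => n /= H x; exact: excess_cut.
Qed.

(** The Kuratowski limit of the cuts along [G]. Since these are eventually confined to a bounded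
    set, it is also their Hausdorff limit, by [limcut_nearby_l] and [limcut_nearby_r]. *)
Definition limcut (a : R) := [set x : 'rV[R]_m | forall e : R, 0 < e ->
  G [set n | exists2 y, acut (v n) a y & edistance x y < e]].

Lemma limcut_subset a b : 0 <= a <= b -> limcut b `<=` limcut a.
Proof.
move=> ab x bx e /bx; apply: filterS => n [y vy xy].
by exists y => //; exact: acut_subset vy.
Qed.

Lemma limcut_ball a x : 0 < a <= 1 -> limcut a x -> enorm x <= r.
Proof.
move=> a01 ax; apply/ler_addgt0Pr => e e0.
have e2 : 0 < e / 2 by rewrite divr_gt0.
have [n [[y vy xy] /(_ y vy) yr]] :=
  @filter_ex _ G _ _ (filterI (ax _ e2) (near_cut_ball a01 e2)).
by move: (enorm_le_edistance x y) xy yr; lra.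
Qed.

Lemma limcut_lim a (y : nat -> 'rV[R]_m) x :
  ulim G y x -> G [set n | acut (v n) a (y n)] -> limcut a x.
Proof.
move=> yx Gy e e0; apply: filterS2 (yx _ e0) Gy => n /= nx vy.
by exists (y n) => //; rewrite edistanceC.
Qed.

Lemma limcut_closed a x :
  (forall e : R, 0 < e -> exists2 y, limcut a y & edistance x y < e) -> limcut a x.
Proof.
move=> ax e e0; have e2 : 0 < e / 2 by rewrite divr_gt0.
have [y ay xy] := ax _ e2.
apply: filterS (ay _ e2) => n [z vz yz]; exists z => //.
by move: (edistance_triangle y x z) xy yz; lra.
Qed.

Lemma limcut_lim_closed a (y : nat -> 'rV[R]_m) x :
  ulim G y x -> G [set n | limcut a (y n)] -> limcut a x.
Proof.
move=> yx Gy; apply: limcut_closed => e e0.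
have [n [/= nx ay]] := @filter_ex _ G _ _ (filterI (yx _ e0) Gy).
by exists (y n) => //; rewrite edistanceC.
Qed.

Lemma limcut_select a (x : nat -> 'rV[R]_m) : 0 < a <= 1 ->
  G [set n | acut (v n) a (x n)] -> exists2 l, limcut a l & ulim G x l.
Proof.
move=> a01 Gx; have [|l xl] := @ulim_exists _ _ _ G UG x (r + 1).
  by apply: filterS2 Gx (near_cut_ball a01 ltr01) => n /= vx; apply.
by exists l => //; exact: limcut_lim Gx.
Qed.

Lemma limcut1_neq0 : limcut 1 !=set0.
Proof.
have /choice[x xP] : forall n, exists x, v n x = 1.
  by move=> n; have [_ [x vx] _ _] := FBv n; exists x.
have [||l l1 _] := @limcut_select 1 x; [by rewrite ltr01 lexx| |by exists l].
by apply: filterE => n /=; rewrite acutE//= xP.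
Qed.

(** Otherwise points of the cuts stay [e]-far from [limcut a] for [G]-many [n], yet their limit
    along [G] belongs to it. *)
Lemma limcut_nearby_l a e : 0 < a <= 1 -> 0 < e ->
  G [set n | nearby (acut (v n) a) (limcut a) e].
Proof.
move=> a01 e0; apply: ultra_contra => Gn.
have /choice[x xP] : forall n, exists x, ~ nearby (acut (v n) a) (limcut a) e ->
    acut (v n) a x /\ forall y, limcut a y -> e <= edistance x y.
  move=> n; have [?|/existsNP[x /not_implyP[vx /forall2NP xP]]] :=
    pselect (nearby (acut (v n) a) (limcut a) e); first by exists 0.
  exists x => _; split=> // y ay; rewrite leNgt; apply/negP.
  by case: (xP y).
have [|l al xl] := @limcut_select a x a01.
  by apply: filterS Gn => n /xP[].
have [n [/= ln /xP[_ /(_ _ al)]]] := @filter_ex _ G _ _ (filterI (xl _ e0) Gn).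
by rewrite leNgt ln.
Qed.

(** The definition of [limcut] approximates one point at a time; uniformity comes from compactness.
    Badly approximated points [x n] have a limit [l] in [limcut a], and points of the cuts close to
    [l] are close to [x n]. *)
Lemma limcut_nearby_r a e : 0 < a <= 1 -> 0 < e ->
  G [set n | nearby (limcut a) (acut (v n) a) e].
Proof.
move=> a01 e0; apply: ultra_contra => Gn.
have /choice[x xP] : forall n, exists x, ~ nearby (limcut a) (acut (v n) a) e ->
    limcut a x /\ forall y, acut (v n) a y -> e <= edistance x y.
  move=> n; have [?|/existsNP[x /not_implyP[vx /forall2NP xP]]] :=
    pselect (nearby (limcut a) (acut (v n) a) e); first by exists 0.
  exists x => _; split=> // y ay; rewrite leNgt; apply/negP.
  by case: (xP y).
have [|l xl] := @ulim_exists _ _ _ G UG x r.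
  by apply: filterS Gn => n /xP[ax _]; exact: limcut_ball ax.
have al : limcut a l.
  by apply: (limcut_lim_closed xl); apply: filterS Gn => n /xP[].
have e2 : 0 < e / 2 by rewrite divr_gt0.
have [n [[/= xln [y vy ly]] /xP[_ /(_ _ vy)]]] :=
  @filter_ex _ G _ _ (filterI (filterI (xl _ e2) (al _ e2)) Gn).
by move: (edistance_triangle l (x n) y) xln ly; lra.
Qed.

(** The value 0 keeps the set nonempty. The cut of [flim] at [a] can be larger than [limcut a],
    since [limcut] need not be left continuous in the level; hence the two separate inclusions
    proved below. *)
Definition flim (x : 'rV[R]_m) : R :=
  sup [set a | a = 0 \/ 0 < a <= 1 /\ limcut a x].

Let flim_has_sup x : has_sup [set a | a = 0 \/ 0 < a <= 1 /\ limcut a x].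
Proof.
split; first by exists 0; left.
by exists 1 => a [->//|[/andP[]]].
Qed.

Lemma flim_ge a x : 0 < a <= 1 -> limcut a x -> a <= flim x.
Proof.
by move=> a01 ax; apply: ub_le_sup; [have [] := flim_has_sup x|right].
Qed.

Lemma flim_ge0 x : 0 <= flim x.
Proof. by apply: ub_le_sup; [have [] := flim_has_sup x|left]. Qed.

Lemma flim_le1 x : flim x <= 1.
Proof. by apply: ge_sup; [have [] := flim_has_sup x|move=> a [->//|[/andP[]]]]. Qed.

Lemma limcut_lt_flim b x : 0 < b < flim x -> limcut b x.
Proof.
move=> /andP[b0 bx]; have [a aP ba] := sup_gt (flim_has_sup x).1 bx.
case: aP => [a0|[a01 ax]]; first by move: ba; rewrite a0 ltNge ltW.
by apply: limcut_subset ax; rewrite !ltW.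
Qed.

Lemma flim_geP a x : 0 < a <= 1 ->
  (forall b, 0 < b < a -> limcut b x) -> a <= flim x.
Proof.
move=> /andP[a0 a1] ax; rewrite leNgt; apply/negP => xa.
pose b := (flim x + a) / 2.
have b1 : flim x < b by rewrite /b; lra.
have b0 : 0 < b by apply: le_lt_trans b1; exact: flim_ge0.
have ba : b < a by rewrite /b; lra.
have : b <= flim x.
  by apply: flim_ge; [rewrite b0/= ltW// (lt_le_trans ba a1)|apply: ax; rewrite b0].
by rewrite leNgt b1.
Qed.

Lemma acut_flim_ball a x : 0 <= a -> acut flim a x -> enorm x <= r.
Proof.
move=> a0 ax; have {ax} : acut flim 0 x by apply: acut_subset ax; rewrite lexx.
rewrite /acut eqxx => clx; apply: (@closed_eball R m r).
apply: closure_subset clx => y /= y0.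
apply: (@limcut_ball (flim y / 2)); last by apply: limcut_lt_flim; lra.
by have := flim_le1 y; lra.
Qed.

Lemma FB_flim : FB R m flim.
Proof.
split.
- by move=> x; rewrite flim_ge0 flim_le1.
- have [x x1] := limcut1_neq0; exists x; apply/eqP; rewrite eq_le flim_le1/=.
  by apply: flim_ge => //; rewrite ltr01 lexx.
- move=> x a xa; have [a1|a1] := ltP 1 a.
    apply/nbhs_edistance; exists 1 => // y _.
    exact: le_lt_trans (flim_le1 y) a1.
  (* If points with [flim >= a] accumulated at [x], they would lie in [limcut b], which is closed,
     and [flim x >= b] would follow. *)
  pose b := (flim x + a) / 2.
  have b1 : flim x < b by rewrite /b; lra.
  have b0 : 0 < b by apply: le_lt_trans b1; exact: flim_ge0.
  have ba : b < a by rewrite /b; lra.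
  apply: contrapT => nx; move: b1; apply/negP; rewrite -leNgt.
  apply: flim_ge; first by rewrite b0/= ltW// (lt_le_trans ba a1).
  apply: limcut_closed => e e0; apply: contrapT => /forall2NP xe; apply: nx.
  apply/nbhs_edistance; exists e => // y xy; rewrite ltNge; apply/negP => ay.
  case: (xe y) => [|//]; apply; apply: limcut_lt_flim.
  by rewrite b0 (lt_le_trans ba).
- by exists r => x; exact: acut_flim_ball.
Qed.

Lemma limcut_sub_acut a : 0 < a <= 1 -> limcut a `<=` acut flim a.
Proof. by move=> a01 x; rewrite acutE//=; [exact: flim_ge|case/andP: a01]. Qed.

Lemma acut_sub_limcut a b : 0 < b < a -> acut flim a `<=` limcut b.
Proof.
move=> /andP[b0 ba] x; rewrite acutE ?(lt_trans b0)//= => ax.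
by apply: limcut_lt_flim; rewrite b0 (lt_le_trans ba).
Qed.

End Limit.

(** * Convergence to the limit fuzzy set in [dp] *)

Section LimitConvergence.
Context {R : realType} {m : nat}.
Variable p : R.
Hypothesis p1 : 1 <= p.
Variables (r : R) (G : set_system nat) (v : nat -> 'rV[R]_m -> R).
Context {UG : UltraFilter G}.
Hypothesis r0 : 0 <= r.
Hypothesis FBv : forall n, FB R m (v n).
Hypothesis excess_v : forall e : R, 0 < e -> G [set n | (excess p r (v n) < e%:E)%E].
Local Notation F := (flim G v).
Local Notation B := (ball_hat r).

Let FBr : FB R m B := FB_ball_hat r0.
Let FBF : FB R m F := FB_flim p1 r0 FBv excess_v.

(** A crude bound for levels near 0 and 1: a point of [acut w a] is within the excess term of the
    ball, which contains [acut F a] and has diameter at most [2 r]. *)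
Lemma hd_excess (w : 'rV[R]_m -> R) a : FB R m w -> 0 < a <= 1 ->
  hd (acut w a) (acut F a) <= 2 * r + dcut (w \max B) B a.
Proof.
move=> FBw a01; have a0 : 0 < a by case/andP: a01.
have a01' : 0 <= a <= 1 by move: a01; lra.
have FBwr := FB_max FBw FBr.
rewrite /dcut /cutdist a01.
have key f : 2 * r + hd (acut (w \max B) a) (acut B a) < f ->
    forall x z, acut w a x -> acut F a z -> edistance x z < f.
  rewrite addrC -ltrBrDr => hf x z wx Fz.
  have [wB _] := hd_lt (acut_nebounded FBwr a01') (acut_nebounded FBr a01') hf.
  have [|y yr xy] := wB x; first by rewrite acut_max//; left.
  move: yr; rewrite acutE//= ball_hatE// => yr.
  have zr : enorm z <= r by exact (acut_flim_ball p1 r0 FBv excess_v (ltW a0) Fz).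
  have yz : edistance y z <= enorm y + enorm z.
    by rewrite /edistance (le_trans (enormD _ _))// enormN.
  by move: (edistance_triangle y x z); lra.
have [[x0 wx0] _] := acut_nebounded FBw a01'; have [[z0 Fz0] _] := acut_nebounded FBF a01'.
apply: hd_le; [exact: acut_nebounded|exact: acut_nebounded|move=> f /key k..].
- by move=> x wx; exists z0 => //; exact: k.
- by move=> z Fz; exists x0 => //; rewrite edistanceC; exact: k.
Qed.

(** Two chains of inclusions, each with one [eta]-approximation: from [acut (v n) a] through level
    [lo] to [acut F (a - h)], and from [acut F (a + h)] through level [lo + h] to [acut (v n) a].
    Comparing the shifted cuts of [F] with [acut F a] adds the other two terms. *)
Lemma hd_flim_grid n (eta h lo a : R) : 0 < eta -> 0 < h < a ->
  0 < lo < a -> a <= lo + h -> a <= 1 - h ->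
  nearby (acut (v n) lo) (limcut G v lo) eta ->
  nearby (limcut G v (lo + h)) (acut (v n) (lo + h)) eta ->
  hd (acut (v n) a) (acut F a) <=
  eta + hd (acut F a) (acut F (a - h)) + hd (acut F (a + h)) (acut F a).
Proof.
move=> eta0 /andP[h0 ha] /andP[lo0 loa] ahi a1 Nlo Nhi.
set t1 := hd (acut F a) _; set t2 := hd (acut F (a + h)) _.
have t10 : 0 <= t1 by exact: hd_ge0.
have t20 : 0 <= t2 by exact: hd_ge0.
have ba : nebounded (acut F a) by apply: acut_nebounded => //; lra.
have bah : nebounded (acut F (a - h)) by apply: acut_nebounded => //; lra.
have bha : nebounded (acut F (a + h)) by apply: acut_nebounded => //; lra.
apply: hd_le => // [|f ef|f ef]; first by apply: acut_nebounded => //; lra.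
- have [|_ N1] := @hd_lt _ _ _ _ (f - eta) ba bah.
    by rewrite -/t1; lra.
  rewrite -(subrKC eta f); apply: nearby_trans N1.
  move=> x vx; have [|z lz xz] := Nlo x; first by apply: acut_subset vx; lra.
  exists z => //; have := limcut_sub_acut _ lz.
  by move=> /(_ ltac:(lra)); apply: acut_subset; lra.
- have [|_ N2] := @hd_lt _ _ _ _ (f - eta) bha ba.
    by rewrite -/t2; lra.
  rewrite -(subrK eta f); apply: nearby_trans N2 _.
  move=> x Fx; have [|z vz xz] := Nhi x; first by apply: acut_sub_limcut Fx; lra.
  by exists z => //; apply: acut_subset vz; lra.
Qed.

Lemma grid_exists N (a : R) : N.+1%:R^-1 < a <= 1 -> exists2 k : nat, (k < N)%N &
  k.+1%:R / N.+1%:R < a <= k.+1%:R / N.+1%:R + N.+1%:R^-1.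
Proof.
move=> /andP[ha a1]; have N0 : N.+1%:R != 0 :> R by rewrite pnatr_eq0.
have ex : exists i, a <= i.+1%:R / N.+1%:R by exists N; rewrite divff.
(* The least grid point at or above [a] is not the first one, because [a > 1 / (N + 1)]; its
   predecessor lies strictly below [a]. *)
case: (ex_minnP ex) => -[|k] ak kmin.
  by move: ak; rewrite div1r leNgt ha.
exists k; first by have := kmin N; rewrite divff// => /(_ a1).
apply/andP; split.
  by rewrite ltNge; apply/negP => /kmin; rewrite ltnn.
by move: ak; rewrite -[in X in X -> _]natr1 mulrDl div1r.
Qed.

Definition grid_close N (eta : R) n := forall k, (k <= N)%N ->
  nearby (acut (v n) (k.+1%:R / N.+1%:R)) (limcut G v (k.+1%:R / N.+1%:R)) eta /\
  nearby (limcut G v (k.+1%:R / N.+1%:R)) (acut (v n) (k.+1%:R / N.+1%:R)) eta.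

Lemma near_grid_close N eta : 0 < eta -> G (grid_close N eta).
Proof.
move=> eta0.
suff H M : (M <= N.+1)%N -> G [set n | forall k, (k < M)%N ->
    nearby (acut (v n) (k.+1%:R / N.+1%:R)) (limcut G v (k.+1%:R / N.+1%:R)) eta /\
    nearby (limcut G v (k.+1%:R / N.+1%:R)) (acut (v n) (k.+1%:R / N.+1%:R)) eta].
  exact: H (leqnn _).
elim: M => [_|M ih MN]; first exact: filterE.
have M01 : 0 < (M.+1%:R / N.+1%:R : R) <= 1.
  by rewrite divr_gt0// ler_pdivrMr// mul1r ler_nat.
have nl := limcut_nearby_l (UG := UG) p1 r0 FBv excess_v M01 eta0.
have nr := limcut_nearby_r (UG := UG) p1 r0 FBv excess_v M01 eta0.
apply: filterS3 (ih (ltnW MN)) nl nr => n Hn n1 n2 k.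
by rewrite ltnS leq_eqVlt => /predU1P[->//|/Hn].
Qed.

(** All summands are nonnegative, so each range of levels uses only those it needs: [hd_excess] on
    the two end intervals of length [h], [hd_flim_grid] between them. *)
Lemma dcut_flim_le N eta n a : 0 < eta -> grid_close N eta n ->
  dcut (v n) F a <= eta * \1_`]0, 1]%classic a + tcut N.+1%:R^-1 F a +
    tcut N.+1%:R^-1 F (a + N.+1%:R^-1) +
    2 * r * \1_`]0, N.+1%:R^-1]%classic a +
    2 * r * \1_`](1 - N.+1%:R^-1), 1]%classic a + dcut (v n \max B) B a.
Proof.
move=> eta0 gc; set h : R := N.+1%:R^-1.
have h0 : 0 < h by rewrite invr_gt0 ltr0Sn.
have T0 x : 0 <= tcut h F x by exact: cutdist_ge0.
have D0 : 0 <= dcut (v n \max B) B a by exact: cutdist_ge0.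
have I0 (A : set R) : 0 <= 2 * r * \1_A a by rewrite mulr_ge0// mulr_ge0.
have E0 : 0 <= eta * \1_`]0, 1]%classic a by rewrite mulr_ge0// ltW.
have [a01|na] := boolP (0 < a <= 1); last first.
  by rewrite {1}/dcut /cutdist (negbTE na) !addr_ge0.
have DE : dcut (v n) F a = hd (acut (v n) a) (acut F a).
  by rewrite /dcut /cutdist a01.
have I1 b c : b < a <= c -> 2 * r * \1_`]b, c]%classic a = 2 * r.
  by move=> bc; rewrite indicE mem_setE in_itv/= bc mulr1.
have [ah|ha] := leP a h.
  have := hd_excess (FBv n) a01; rewrite -DE (I1 0 h); last by rewrite ah; case/andP: a01 => ->.
  by move: (T0 a) (T0 (a + h)) (I0 `]1 - h, 1]%classic); lra.
have [ah1|ha1] := leP a (1 - h); last first.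
  have := hd_excess (FBv n) a01; rewrite -DE (I1 (1 - h) 1); last by rewrite ha1; case/andP: a01.
  by move: (T0 a) (T0 (a + h)) (I0 `]0, h]%classic); lra.
have [k kN kP] : exists2 k : nat, (k < N)%N &
    k.+1%:R / N.+1%:R < a <= k.+1%:R / N.+1%:R + h.
  by apply: grid_exists; case/andP: a01 => _ ->; rewrite -/h ha.
have lo0 : 0 < k.+1%:R / N.+1%:R :> R by rewrite divr_gt0.
have [Nlo _] := gc k (ltnW kN); have [_ Nhi] := gc k.+1 kN.
have hiE : k.+2%:R / N.+1%:R = k.+1%:R / N.+1%:R + h.
  by rewrite -[in LHS]natr1 mulrDl div1r.
rewrite hiE in Nhi.
have := @hd_flim_grid n eta h (k.+1%:R / N.+1%:R) a eta0.
rewrite lo0 h0 ha; case/andP: kP => -> -> /(_ isT isT isT ah1 Nlo Nhi) H.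
rewrite DE; apply: (le_trans H).
have -> : hd (acut F a) (acut F (a - h)) = tcut h F a.
  by rewrite /tcut /cutdist ha; case/andP: a01 => _ ->.
have -> : hd (acut F (a + h)) (acut F a) = tcut h F (a + h).
  by rewrite /tcut /cutdist addrK ltrDr; case/andP: a01 => -> _; rewrite ifT//; lra.
have -> : eta * \1_`]0, 1]%classic a = eta.
  by rewrite indicE mem_setE in_itv/= a01 mulr1.
by move: (I0 `]0, h]%classic) (I0 `]1 - h, 1]%classic); lra.
Qed.

(** Measurability travels with the bound, so that Minkowski's inequality can be iterated over a long
    sum. *)
Definition LpN_bound (f : R -> R) (c : R) := mfunR f /\ (LpN p f <= c%:E)%E.

Lemma LpN_boundD f g c d : LpN_bound f c -> LpN_bound g d ->
  LpN_bound (fun x => f x + g x) (c + d).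
Proof.
move=> [mf fc] [mg gd]; split; first exact: measurable_funD.
by apply: le_trans (LpND p1 mf mg) _; rewrite EFinD leeD.
Qed.

Lemma LpN_bound_itv (a b c d : R) : a <= b -> 0 <= c -> c * (b - a) `^ p^-1 <= d ->
  LpN_bound (fun x => c * \1_`]a, b]%classic x) d.
Proof.
move=> ab c0 cd; split; last by rewrite LpN_itv.
by apply: measurable_funM; [exact: measurable_cst|exact: measurable_indic].
Qed.

Lemma flim_cvg (e : R) : 0 < e -> G [set n | (dp p (v n) F < e%:E)%E].
Proof.
move=> e0; have e8 : 0 < e / 8 by rewrite divr_gt0.
have [d d0 dP] := tcut_cvg0 p1 FBF e8.
have p0 : 0 < p by exact: lt_le_trans p1.
(* Chosen so that [h <= c^p] gives [2 r h^(1/p) <= 2 (r + 1) c = e / 8]; using [r + 1] avoids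
   dividing by 0. *)
pose c := e / (16 * (r + 1)).
have r1 : 0 < r + 1 by rewrite ltr_wpDl.
have c0 : 0 < c by rewrite divr_gt0// mulr_gt0.
have cp0 : 0 < c `^ p by rewrite powR_gt0.
have [N Nd Nc] : exists2 N, N.+1%:R^-1 < d & N.+1%:R^-1 < c `^ p.
  have [N _ NP] := filterI (near_infty_natSinv_lt (PosNum d0))
    (near_infty_natSinv_lt (PosNum cp0)).
  by have [] := NP N (leqnn N); exists N.
pose h : R := N.+1%:R^-1.
have h0 : 0 < h by rewrite invr_gt0 ltr0Sn.
have h1 : h <= 1 by rewrite invf_le1// ler1n.
have hc : 2 * r * h `^ p^-1 <= e / 8.
  have hpc : h `^ p^-1 <= c.
    rewrite -[leRHS](powRr1 (ltW c0)) -(divff (lt0r_neq0 p0)) powRrM.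
    apply: ge0_ler_powR; [by rewrite invr_ge0 ltW|by rewrite nnegrE ltW| |exact: ltW].
    by rewrite nnegrE powR_ge0.
  have -> : e / 8 = 2 * (r + 1) * c by rewrite /c; field; rewrite gt_eqF.
  rewrite -!mulrA ler_pM2l// ler_pM ?powR_ge0//; lra.
have Bt : LpN_bound (tcut h F) (e / 8).
  by split; [exact: mfun_tcut (ltW h0)|apply: dP; rewrite ltW].
have Bs : LpN_bound (fun a => tcut h F (a + h)) (e / 8).
  split; first exact: mfunR_shift Bt.1.
  by rewrite (LpN_shift p h Bt.1); exact: Bt.2.
have Beta : LpN_bound (fun a => e / 8 * \1_`]0, 1]%classic a) (e / 8).
  by apply: LpN_bound_itv => //; [exact: ltW|rewrite subr0 powR1 mulr1].
have Bl : LpN_bound (fun a => 2 * r * \1_`]0, h]%classic a) (e / 8).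
  by apply: LpN_bound_itv; [exact: ltW|rewrite mulr_ge0|rewrite subr0].
have Br : LpN_bound (fun a => 2 * r * \1_`](1 - h), 1]%classic a) (e / 8).
  apply: LpN_bound_itv; [by rewrite gerBl ltW|by rewrite mulr_ge0|].
  by rewrite opprB addrCA subrr addr0.
apply: filterS2 (near_grid_close N e8) (excess_v e8) => n gc exc /=.
have FBvr := FB_max (FBv n) FBr.
have Bexc : LpN_bound (dcut (v n \max B) B) (e / 8).
  by split; [exact: mfun_dcut|rewrite -dpE//; exact: ltW exc].
(* Six terms of norm at most [e / 8] add up to less than [e]. *)
have [mg gle] := LpN_boundD (LpN_boundD (LpN_boundD (LpN_boundD (LpN_boundD
  Beta Bt) Bs) Bl) Br) Bexc.
rewrite dpE//.
apply: (@le_lt_trans _ _ (e / 8 + e / 8 + e / 8 + e / 8 + e / 8 + e / 8)%:E);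
  last by rewrite lte_fin; lra.
apply: le_trans gle.
apply: LpN_le => //; first exact: mfun_dcut.
by move=> a; rewrite cutdist_ge0/=; exact: dcut_flim_le.
Qed.

End LimitConvergence.

(** * Each of the four classes contains the limits of its sequences *)

Section LimitClasses.
Context {R : realType} {m : nat}.
Variable p : R.
Hypothesis p1 : 1 <= p.
Variables (r : R) (G : set_system nat) (v : nat -> 'rV[R]_m -> R).
Context {UG : UltraFilter G}.
Hypothesis r0 : 0 <= r.
Hypothesis FBv : forall n, FB R m (v n).
Hypothesis excess_v : forall e : R, 0 < e -> G [set n | (excess p r (v n) < e%:E)%E].
Local Notation F := (flim G v).

Let FBF : FB R m F := FB_flim p1 r0 FBv excess_v.

Lemma edistance_comb (l e : R) (x y x' y' : 'rV[R]_m) : 0 <= l <= 1 ->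
  edistance x x' < e -> edistance y y' < e ->
  edistance (l *: x + (1 - l) *: y) (l *: x' + (1 - l) *: y') < e.
Proof.
move=> /andP[l0 l1] xx yy; rewrite /edistance opprD addrACA -!scalerBr.
apply: le_lt_trans (enormD _ _) _; rewrite !enormZ !ger0_norm ?subr_ge0//.
rewrite -/(edistance x x') -/(edistance y y').
pose M := Num.max (edistance x x') (edistance y y').
have Me : M < e by rewrite gt_max xx yy.
have xM : l * edistance x x' <= l * M by rewrite ler_wpM2l// le_max lexx.
have yM : (1 - l) * edistance y y' <= (1 - l) * M.
  by rewrite ler_wpM2l ?subr_ge0// le_max lexx orbT.
by lra.
Qed.

Lemma limcut_star (a : R) (c : nat -> 'rV[R]_m) x y (l : R) : 0 <= l <= 1 ->
  ulim G c x ->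
  G [set n | forall z, acut (v n) a z -> acut (v n) a (l *: z + (1 - l) *: c n)] ->
  limcut G v a y -> limcut G v a (l *: y + (1 - l) *: x).
Proof.
move=> l01 cx Gc ay e e0.
apply: filterS3 (cx _ e0) Gc (ay _ e0) => n /= cnx star [z vz yz].
exists (l *: z + (1 - l) *: c n); first exact: star.
by apply: edistance_comb => //; rewrite edistanceC.
Qed.

(** Allows [a <= 0], since the class inequalities have values of [F] on the left, which may
    vanish. *)
Lemma flim_geP_pos a x : a <= 1 ->
  (forall b, 0 < b < a -> b <= 1 -> limcut G v b x) -> a <= F x.
Proof.
move=> a1 H; have [a0|a0] := leP a 0; first exact: le_trans (flim_ge0 _ _ _).
apply: flim_geP; first by rewrite a0.
by move=> b /andP[b0 ba]; apply: H; [rewrite b0|exact: ltW (lt_le_trans ba a1)].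
Qed.

Lemma flim_E : (forall n, fuzzy_E R m (v n)) -> fuzzy_E R m F.
Proof.
move=> Ev; split=> // x y l l01.
apply: flim_geP_pos; first by rewrite ge_min flim_le1.
move=> b /andP[b0]; rewrite lt_min => /andP[bx b_y] b1 e e0.
have bX : limcut G v b x by apply: limcut_lt_flim; rewrite b0.
have bY : limcut G v b y by apply: limcut_lt_flim; rewrite b0.
apply: filterS2 (bX _ e0) (bY _ e0) => n [x' vx xx] [y' vy yy].
exists (l *: x' + (1 - l) *: y'); last exact: edistance_comb.
rewrite acutE//= in vx vy *; have [_ /(_ x' y' l l01)] := Ev n.
by apply: le_trans; rewrite le_min vx.
Qed.

Lemma flim_S0 : (forall n, fuzzy_S0 R m (v n)) -> fuzzy_S0 R m F.
Proof.
move=> Sv; split=> // y l l01; apply: flim_geP_pos; first exact: flim_le1.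
move=> b /andP[b0 b_y] b1.
have -> : l *: y = l *: y + (1 - l) *: 0 by rewrite scaler0 addr0.
apply: (@limcut_star _ (fun=> 0)) => //.
- by move=> e e0; apply: filterE => n /=; rewrite edistancexx.
- apply: filterE => n z; rewrite scaler0 addr0 !acutE//= => vz.
  by have [_ /(_ z l l01)] := Sv n; exact: le_trans.
- by apply: limcut_lt_flim; rewrite b0.
Qed.

Lemma flim_S : (forall n, fuzzy_S R m (v n)) -> fuzzy_S R m F.
Proof.
move=> Sv; split=> //.
have /choice[c cP] : forall n, exists c, forall y (l : R), 0 <= l <= 1 ->
    v n y <= v n (l *: y + (1 - l) *: c) by move=> n; have [] := Sv n.
have lt01 : 0 < (1 : R) <= 1 by rewrite ltr01 lexx.
have Gc : G [set n | acut (v n) 1 (c n)].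
  apply: filterE => n /=; rewrite acutE//=.
  have [_ [z vz] _ _] := FBv n.
  (* At [l = 0], with [z] of value 1, the star inequality gives the centre value 1. The centres thus
     stay bounded along [G] and have a limit, which serves all levels. *)
  have := cP n z 0; rewrite lexx ler01 => /(_ isT).
  by rewrite scale0r add0r subr0 scale1r vz.
have [x x1 cx] := limcut_select (UG := UG) p1 r0 FBv excess_v lt01 Gc.
exists x => y l l01; apply: flim_geP_pos; first exact: flim_le1.
move=> b /andP[b0 b_y] b1; apply: (limcut_star l01 cx).
- apply: filterE => n z; rewrite !acutE//= => vz.
  exact: le_trans (cP n z l l01).
- by apply: limcut_lt_flim; rewrite b0.
Qed.

Lemma limcut_center (a : R) : (forall n, fuzzy_Stilde R m (v n)) -> 0 < a <= 1 ->
  exists x, limcut G v a x /\ forall y (l : R), 0 <= l <= 1 -> limcut G v a y ->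
    limcut G v a (l *: y + (1 - l) *: x).
Proof.
move=> Sv a01; have /choice[c cP] : forall n, exists c, acut (v n) a c /\
    forall y, acut (v n) a y -> forall l : R, 0 <= l <= 1 ->
      acut (v n) a (l *: y + (1 - l) *: c).
  by move=> n; have [_ /(_ a a01)[c vc cP]] := Sv n; exists c.
have Gc : G [set n | acut (v n) a (c n)].
  by apply: filterE => n /=; have [] := cP n.
have [x ax cx] := limcut_select (UG := UG) p1 r0 FBv excess_v a01 Gc.
exists x; split=> // y l l01; apply: (limcut_star l01 cx).
by apply: filterE => n z vz; have [_ /(_ z vz l l01)] := cP n.
Qed.

(** Centres now depend on the level, and the cut of [F] at [a] is only an intersection of limit
    cuts. Levels [b k] increase to [a]; the centres of [limcut (b k)] have a limit along [G], this
    time in [k], which is a centre at level [a] because each [limcut b'] with [b' < a] is closed and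
    contains [limcut (b k)] for [G]-many [k]. *)
Lemma flim_Stilde : \oo `<=` G -> (forall n, fuzzy_Stilde R m (v n)) ->
  fuzzy_Stilde R m F.
Proof.
move=> Goo Sv; split=> // a /andP[a0 a1].
pose b k : R := a - a / k.+2%:R.
have b01 k : 0 < b k < a.
  rewrite subr_gt0 gtrBl divr_gt0// andbT ltr_pdivrMr//.
  by rewrite ltr_pMr// ltr1n.
have b01' k : 0 < b k <= 1.
  by have /andP[-> /ltW ba] := b01 k; exact: le_trans a1.
have /choice[c cP] : forall k, exists x, limcut G v (b k) x /\
    forall y (l : R), 0 <= l <= 1 -> limcut G v (b k) y ->
    limcut G v (b k) (l *: y + (1 - l) *: x).
  by move=> k; exact: limcut_center.
have near_b b' : b' < a -> G [set k | b' < b k].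
  move=> ba; apply: Goo; have d0 : 0 < (a - b') / a by rewrite divr_gt0// subr_gt0.
  have [N _ NP] := near_infty_natSinv_lt (PosNum d0).
  exists N => // k /= /leqW/NP /= kd; rewrite /b ltrBrDl -ltrBrDr.
  by rewrite mulrC -ltr_pdivlMr.
have [|x cx] := @ulim_exists _ _ _ G UG c r.
  apply: filterE => k /=.
  by apply: (limcut_ball p1 r0 FBv excess_v (b01' k)); have [] := cP k.
have sub b' k : 0 < b' -> b' < b k -> limcut G v (b k) `<=` limcut G v b'.
  by move=> b'0 b'k; apply: limcut_subset; rewrite !ltW.
exists x.
  rewrite acutE//=; apply: flim_geP_pos => // b' /andP[b'0 b'a] _.
  apply: (limcut_lim_closed cx); apply: filterS (near_b _ b'a) => k b'k.
  by apply: sub b'k _ _ => //; have [] := cP k.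
move=> y ay l l01; rewrite acutE//=; apply: flim_geP_pos => // b' /andP[b'0 b'a] _.
apply: (@limcut_lim_closed _ _ _ _ UG _ (fun k => l *: y + (1 - l) *: c k)).
  move=> e e0; apply: filterS (cx _ e0) => k /= ck.
  by apply: edistance_comb => //; rewrite edistancexx.
apply: filterS (near_b _ b'a) => k b'k.
apply: sub b'k _ _ => //; have [_] := cP k; apply=> //.
exact: acut_sub_limcut (b01 k) _ ay.
Qed.

End LimitClasses.

Theorem theorem6p18 (R : realType) (m : nat) (p : R)
    (X U : set ('rV[R]_m -> R)) :
  (1 <= m)%N -> 1 <= p ->
  [\/ X = fuzzy_Stilde R m, X = fuzzy_E R m, X = fuzzy_S0 R m
    | X = fuzzy_S R m] ->
  U `<=` X ->
  compact [set u : dp_space p X | U u] <->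
  [/\ closed [set u : dp_space p X | U u],
      p_mean_bounded p U,
      p_mean_equi_left_continuous p U &
      forall u : nat -> 'rV[R]_m -> R, (forall n, U (u n)) ->
        exists r : R, 0 < r /\
        exists phi : nat -> nat,
          {homo phi : i j / (i < j)%N} /\
          excess p r (u (phi n)) @[n --> \oo] --> 0%:E].
Proof.
move=> _ p1 Xclass UX.
have XFB : X `<=` FB R m by case: Xclass => -> u [].
split=> [cU|[clU _ _ excU]].
  split.
  - exact: compact_closed_dp p1 XFB cU.
  - exact: compact_p_mean_bounded p1 XFB UX cU.
  - exact: compact_equi_left_continuous p1 XFB UX cU.
  - exact: compact_excess_cvg0 p1 XFB UX cU.
apply: (seq_cluster_compact p1 XFB) => u Uu.
have [r [r_gt0 [phi [phi_homo phi_exc]]]] := excU (fun n => u n) Uu.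
have r0 := ltW r_gt0.
(* Every member of [G] meets every tail, so convergence along [G] will give approximations of
   arbitrarily large index. *)
have [G [UG Goo]] := ultraFilterLemma eventually_filter.
pose v n : 'rV[R]_m -> R := u (phi n).
have Xv n : X (v n) by exact: dp_valP.
have FBv n : FB R m (v n) by exact/XFB.
have exc_v e : 0 < e -> G [set n | (excess p r (v n) < e%:E)%E].
  move=> e0; apply: Goo; have /fine_cvgP[fin cv] := phi_exc.
  have /cvgrPdist_lt/(_ _ e0) := cv; apply: filterS2 fin => n /= fin.
  rewrite sub0r normrN -/(v n) => exc_n; rewrite -(fineK fin) lte_fin.
  exact: le_lt_trans (ler_norm _) exc_n.
have XF : X (flim G v).
  case: Xclass Xv => -> Xv.
  - exact: (flim_Stilde (UG := UG) p1 r0 FBv exc_v Goo Xv).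
  - exact: (flim_E (UG := UG) p1 r0 FBv exc_v Xv).
  - exact: (flim_S0 (UG := UG) p1 r0 FBv exc_v Xv).
  - exact: (flim_S (UG := UG) p1 r0 FBv exc_v Xv).
have FBF := XFB _ XF.
pose w : dp_space p X := DpSpace p XF.
have w_near (e : R) N : 0 < e ->
    exists2 n, (N <= n)%N & (dp p w (u n) < e%:E)%E.
  move=> e0; have GN : G [set n | (N <= n)%N] by apply: Goo; exists N.
  have Ge := flim_cvg (UG := UG) p1 r0 FBv exc_v e0.
  have [n [Nn vn]] := @filter_ex _ G _ _ (filterI GN Ge).
  exists (phi n); last by rewrite (dpC p1 FBF (FBv n)).
  (* A strictly increasing [phi] satisfies [n <= phi n]. *)
  apply: leq_trans Nn _; elim: n {vn} => // n ih.
  exact: leq_ltn_trans ih (phi_homo _ _ (ltnSn n)).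
exists w; last exact: w_near.
(* The limit is a point of [X] approximated by members of [U], so closedness puts it in [U]. *)
apply: clU => V /(nbhs_dp p1 XFB)[e e0 eV].
have [n _ wn] := w_near e 0%N e0.
by exists (u n); split; [exact: Uu|exact: eV].
Qed.
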